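(* Consider the AURWM regime (defined in the context) with $n=\lfloor p^k\rfloor$ for some fixed $k\in(0,1)$. Assume that the base algorithm $\mathcal{A}$ satisfies the iteration-count assumption stated in the context, with iteration-count function $T(\epsilon,p,\beta)$. Let $r>1$ and write $\delta=r-1$. Then there exist universal positive constants $A_1,A_2$ such that, if the ETS algorithm is run with overall iteration count for $\mathcal{A}$ no more than $T(A_1\delta,p,\beta)$ (i.e. $\hat\beta$ is the output of $\mathcal{A}$ provided by the assumption at tolerance $\epsilon=A_1\delta$), with partition parameter $\gamma\in\left(0,\frac{\delta}{8+8\delta}\right)$, and with threshold parameter $\varsigma=(1+A_2\delta)^{1/2}$, then the ETS selector $\hat\eta=\hat\eta(X,Y)$ satisfies $$\lim_{p\to\infty}\ \sup_{\beta\in\mathcal{M}_s^a}\ \mathbb{P}_\beta(\hat\eta\neq\eta_\beta)=0.$$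
   Context: Model: $Y=X\beta+E$, where $X\in\mathbb{R}^{n\times p}$ has i.i.d. rows $x_i\sim N_p(0,I_p)$, $E$ has i.i.d. $N(0,1)$ entries, and $X,E$ are independent. $\mathbb{P}_\beta$ is the law of the data when the coefficient vector is $\beta\in\mathbb{R}^p$. $\mathcal{S}(v)=\{j: v_j\neq 0\}$, $\|v\|_0=|\mathcal{S}(v)|$. Signal class: $\mathcal{M}_s^a=\{\beta\in\mathbb{R}^p:\ \|\beta\|_0=s,\ \min_{j\in\mathcal{S}(\beta)}|\beta_j|\ge a\}$. The binary decoder of the support is $\eta_\beta=(\mathbf{1}\{\beta_1\neq0\},\dots,\mathbf{1}\{\beta_p\neq0\})^\top$. AURWM regime: $p\to\infty$, $n=\lfloor p^k\rfloor$ with fixed $k\in(0,1)$, $s=s_p=O(\log p)$, $a=\left(\frac{2r\log p}{n}\right)^{1/2}$ with $r>0$ a fixed constant. ''Universal'' means not depending on $k,r,\gamma,n,p,s,\beta$ or the algorithm. ETS (Estimate Then Screen) algorithm. Given $\gamma\in(0,1)$, the sample is randomly partitioned (independently of the data) into $\mathcal{D}_1=(X^{(1)},Y^{(1)})$ of size $n_1=\lfloor\gamma n\rfloor$ and $\mathcal{D}_2=(X^{(2)},Y^{(2)})$ of size $n_2=n-n_1$; $X^{(\ell)}\in\mathbb{R}^{n_\ell\times p}$, $Y^{(\ell)}\in\mathbb{R}^{n_\ell}$, and $X^{(2)}_i$ is the $i$th column of $X^{(2)}$. Estimation step: given an objective function $f_{n_1}(\cdot;\mathcal{D}_1)$ and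 a constraint set $\mathcal{C}\subseteq\mathbb{R}^p$, an iterative algorithm $\mathcal{A}(\cdot,\cdot)$ for approximately solving $\min_{\theta\in\mathcal{C}}f_{n_1}(\theta;\mathcal{D}_1)$, with tuning parameters $\mathcal{T}_{\mathcal A}$, outputs $\hat\beta=\mathcal{A}(f_{n_1}(\cdot;\mathcal{D}_1),\mathcal{T}_{\mathcal A})$. In particular $\hat\beta$ depends on the data only through $\mathcal{D}_1$. Screening step: for $i\in[p]$ set $$\Delta_i=\frac{X_i^{(2)\top}\big(Y^{(2)}-\sum_{j\neq i}X_j^{(2)}\hat\beta_j\big)}{\|X_i^{(2)}\|_2},\qquad \kappa_\varsigma(u)=\frac{a\|u\|_2}{2}+\frac{\varsigma^2\log p}{a\|u\|_2}\quad(u\in\mathbb{R}^{n_2}),$$ where $\varsigma>0$, and $\hat\eta_i(X,Y)=\mathbf{1}\{|\Delta_i|>\kappa_\varsigma(X_i^{(2)})\}$. The ETS selector is $\hat\eta(X,Y)=(\hat\eta_1(X,Y),\dots,\hat\eta_p(X,Y))^\top$. Iteration-count assumption on $\mathcal{A}$: the following holds with probability converging to 1 as $p\to\infty$, meaning that there is a sequence $\alpha_p\ge0$ with $\alpha_p\to0$ such that for every $\beta\in\mathcal{M}_s^a$ it holds with $\mathbb{P}_\beta$-probability at least $1-\alpha_p$: for any given tolerance level $\epsilon>0$, there exists a suitable set of deterministic tuning parameters $\mathcal{T}_{\mathcal A}$ such that $\mathcal{A}$ requires no more than $T(\epsilon,p,\beta)$ iterations to produce a solution $\hat\beta=\mathcal{A}(f_{n_1}(\cdot;\mathcal{D}_1),\mathcal{T}_{\mathcal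 A})$ with $\|\hat\beta-\beta\|_2^2\le\epsilon$. *)

(* Defs.v *)
From HB Require Import structures.
From mathcomp Require Import all_boot all_order all_algebra.
From mathcomp Require Import all_classical all_reals all_analysis.

Set Implicit Arguments.
Unset Strict Implicit.
Unset Printing Implicit Defensive.

Import Order.TTheory GRing.Theory Num.Theory.
Import numFieldNormedType.Exports.

Local Open Scope classical_set_scope.
Local Open Scope ring_scope.

(* The canonical norm of matrices in MathComp-Analysis is the sup norm, hence
   an explicit Euclidean norm. *)
Definition sqnorm2 (R : realType) (m : nat) (v : 'cV[R]_m) : R :=
  \sum_(i < m) v i 0 ^+ 2.

Definition norm2 (R : realType) (m : nat) (v : 'cV[R]_m) : R :=
  Num.sqrt (sqnorm2 v).

Definition supp (R : realType) (p : nat) (v : 'cV[R]_p) : {set 'I_p} :=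
  [set j | v j 0 != 0]%SET.

Definition signal_class (R : realType) (p s : nat) (a : R) : set 'cV[R]_p :=
  [set v | #|supp v| = s /\ forall j, j \in supp v -> a <= `|v j 0| ].

Definition decoder (R : realType) (p : nat) (v : 'cV[R]_p) : 'cV[bool]_p :=
  \col_j (v j 0 != 0).

Definition nobs (R : realType) (k : R) (p : nat) : nat :=
  Num.truncn (p%:R `^ k : R).

Definition min_signal (R : realType) (r : R) (n p : nat) : R :=
  Num.sqrt (2 * r * ln p%:R / n%:R).

Definition est_size (R : realType) (gamma : R) (n : nat) : nat :=
  Num.truncn (gamma * n%:R).

Section probability.
Context (d : measure_display) (T : measurableType d) (R : realType).
Variable P : probability T R.

Definition independent_pair (F G : set (set T)) : Prop :=
  forall A B, F A -> G B -> P (A `&` B) = (P A * P B)%E.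

Definition independent_family (I : finType) (F : I -> set (set T)) : Prop :=
  forall (J : {set I}) (A : I -> set T), (forall i, i \in J -> F i (A i)) ->
    P (\bigcap_(i in [set` J]) A i) = (\prod_(i in J) P (A i))%E.

(* Z ~ N(0, Id), by independence of the N(0, 1) coordinates.  The laws are
   compared on Borel sets only, P being meaningless on other sets. *)
Definition std_normal (I : finType) (Z : I -> T -> R) : Prop :=
  [/\ forall i, measurable_fun setT (Z i),
      forall i (B : set R), measurable B ->
        P (Z i @^-1` B) = normal_prob 0 1 B
    & independent_family (fun i => g_sigma_algebra_preimage (Z i))].

End probability.

(* The sigma-algebra sigma(Z_i, i in I). *)
Definition sigma_of (U : Type) (R : realType) (I : Type) (Z : I -> U -> R) :
    set (set U) :=
  <<s \bigcup_(i in [set: I]) preimage_set_system setT (Z i) measurable >>.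

Definition dataset (R : realType) (m p : nat) : Type :=
  ('M[R]_(m, p) * 'cV[R]_m)%type.

Definition dataset_coord (R : realType) (m p : nat)
    (ij : 'I_m * 'I_p + 'I_m) (D : dataset R m p) : R :=
  match ij with
  | inl (i, j) => D.1 i j
  | inr i => D.2 i 0
  end.

Definition subsample (R : realType) (n p : nat) (D : dataset R n p)
    (A : {set 'I_n}) : dataset R #|A| p :=
  (rowsub (@enum_val _ (mem A)) D.1, rowsub (@enum_val _ (mem A)) D.2).

(* w |-> part w is the set of the observations put in the first part. *)
Record regression_model (d : measure_display) (T : measurableType d)
    (R : realType) (P : probability T R) (n p n1 : nat)
    (X : T -> 'M[R]_(n, p)) (E : T -> 'cV[R]_n) (part : T -> {set 'I_n}) :
    Prop := RegressionModel {
  row_normal : forall i, std_normal P (fun (j : 'I_p) w => X w i j) ;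
  row_independent : independent_family P
    (fun i => sigma_of (fun (j : 'I_p) w => X w i j)) ;
  noise_normal : std_normal P (fun (i : 'I_n) w => E w i 0) ;
  design_noise_independent : independent_pair P
    (sigma_of (fun (ij : 'I_n * 'I_p) w => X w ij.1 ij.2))
    (sigma_of (fun (i : 'I_n) w => E w i 0)) ;
  part_size : forall w, #|part w| = n1 ;
  part_measurable : forall A, measurable (part @^-1` [set A]) ;
  part_independent : independent_pair P
    (preimage_set_system setT part setT)
    (sigma_of (fun ij w => dataset_coord ij (X w, E w))) }.

Definition sample (T : Type) (R : realType) (n p : nat)
    (X : T -> 'M[R]_(n, p)) (E : T -> 'cV[R]_n) (b : 'cV[R]_p) (w : T) :
    dataset R n p :=
  (X w, X w *m b + E w).

(* An iterative algorithm for minimising an objective over a constraint set: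
   its iterates, and the number of iterations performed before it stops. *)
Record iter_algorithm (R : realType) (p : nat) := IterAlgorithm {
  tuning : Type ;
  iterate : ('cV[R]_p -> R) -> set 'cV[R]_p -> tuning -> nat -> 'cV[R]_p ;
  iter_count : ('cV[R]_p -> R) -> set 'cV[R]_p -> tuning -> nat }.

Definition alg_output (R : realType) (p : nat) (Alg : iter_algorithm R p)
    (f : 'cV[R]_p -> R) (C : set 'cV[R]_p) (t : tuning Alg) : 'cV[R]_p :=
  iterate f C t (iter_count f C t).

Definition measurable_estimator (R : realType) (m p : nat)
    (bhat : dataset R m p -> 'cV[R]_p) : Prop :=
  forall (j : 'I_p) (B : set R), measurable B ->
    sigma_of (@dataset_coord R m p) [set D | B (bhat D j 0)].

(* tau p eps b are the deterministic tuning parameters of the algorithm for the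
   tolerance eps.  The event is only required to contain a measurable event of
   probability at least 1 - alpha p, since it need not be measurable itself. *)
Definition iteration_count_assumption (R : realType) (n s : nat -> nat)
    (a : nat -> R)
    (d : nat -> measure_display) (Om : forall p, measurableType (d p))
    (P : forall p, probability (Om p) R)
    (X : forall p, Om p -> 'M[R]_(n p, p)) (E : forall p, Om p -> 'cV[R]_(n p))
    (part : forall p, Om p -> {set 'I_(n p)})
    (f : forall p m, dataset R m p -> 'cV[R]_p -> R)
    (C : forall p, set 'cV[R]_p)
    (Alg : forall p, iter_algorithm R p)
    (tau : forall p, R -> 'cV[R]_p -> tuning (Alg p))
    (T : R -> forall p, 'cV[R]_p -> R) : Prop :=
  exists2 alpha : nat -> R,
    (forall p, 0 <= alpha p) /\ (alpha p @[p --> \oo] --> (0 : R)) &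
    forall (p : nat) (b : 'cV[R]_p), signal_class (s p) (a p) b ->
    exists G : set (Om p),
      [/\ measurable G, ((1 - alpha p)%:E <= P p G)%E &
          forall w, G w -> forall eps : R, 0 < eps ->
          let fD1 := f p _ (subsample (sample (X p) (E p) b w) (part p w)) in
          (iter_count fD1 (C p) (tau p eps b))%:R <= T eps p b /\
          sqnorm2 (alg_output fD1 (C p) (tau p eps b) - b) <= eps].

Definition kappa (R : realType) (a varsigma : R) (p m : nat) (u : 'cV[R]_m) :
    R :=
  a * norm2 u / 2 + varsigma ^+ 2 * ln p%:R / (a * norm2 u).

Definition Delta (R : realType) (m p : nat) (D : dataset R m p)
    (bhat : 'cV[R]_p) (i : 'I_p) : R :=
  ((col i D.1)^T *m
     (D.2 - \sum_(j < p | j != i) bhat j 0 *: col j D.1)) 0 0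
  / norm2 (col i D.1).

Definition screen (R : realType) (a varsigma : R) (m p : nat)
    (D : dataset R m p) (bhat : 'cV[R]_p) : 'cV[bool]_p :=
  \col_i (kappa a varsigma p (col i D.1) < `|Delta D bhat i|).

Definition ets (R : realType) (a varsigma : R) (n p : nat)
    (f : forall m, dataset R m p -> 'cV[R]_p -> R) (C : set 'cV[R]_p)
    (Alg : iter_algorithm R p) (t : tuning Alg)
    (D : dataset R n p) (A : {set 'I_n}) : 'cV[bool]_p :=
  screen a varsigma (subsample D (~: A)%SET)
    (alg_output (f _ (subsample D A)) C t).

(* Main.v *)
Require Import Defs.
From HB Require Import structures.
From mathcomp Require Import all_boot all_order all_algebra.
From mathcomp Require Import all_classical all_reals all_analysis.
From mathcomp Require Import measurable_realfun ring lra.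

Set Implicit Arguments.
Unset Strict Implicit.
Unset Printing Implicit Defensive.

Import Order.TTheory GRing.Theory Num.Theory.
Import numFieldNormedType.Exports.

Local Open Scope classical_set_scope.
Local Open Scope ring_scope.

(** The constants are A1 = 1/4 and A2 = 1/2.  Write L = ln p, and let h be the
    estimate computed from the first part of the sample.

    Plugging the model into the screening statistic gives
      Delta_i = |X_i| b_i + noise_i,
      noise_i = sum_m (X_mi / |X_i|) (E_m + sum_(j != i) X_mj (b_j - h_j)),
    with m ranging over the second part ([Delta_test]).  Once the first part and
    the column X_i are fixed, noise_i is a linear form in independent N(0, 1)
    variables whose squared coefficients add up to at most 1 + |h - b|^2
    ([noise_coef_sqr_sum]).  So, where the estimate is accurate to within eps,
    noise_i has Gaussian tails with variance 1 + eps: this is the Chernoff bound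
    of [conditional_gaussian_tail], and it rests on integrating out the
    remaining coordinates first ([integral_coord_split]).

    A null coordinate is selected only if |noise_i| exceeds the threshold, which
    by AM-GM is at least (2 (1 + delta/2) L)^(1/2) for all |X_i| > 0.  This has
    probability at most 2 p^(-(1 + delta/2)/(1 + delta/4)), which is o(1/p): the
    p nulls can be summed ([null_selected_prob]).

    A signal is missed only if |noise_i| exceeds x/2 - (1 + delta/2) L / x with
    x = a |X_i|.  The bound on gamma makes x^2 at least 2 (1 + 3 delta/4) L
    unless |X_i|^2 is abnormally small ([test_signal_strength]), and then the
    gap is of order L^(1/2): the noise exceeds it with probability at most
    2 p^(-c) for some c > 0.  An abnormally small |X_i|^2 has probability
    exponentially small in n ([col_sqnorm_lower_tail]).  Only s = O(L) signals
    have to be summed ([signal_missed_prob]).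

    All of this is done for a fixed split of the sample, and integrated over the
    random split, which is independent of the data ([partition_mixture]).  The
    total is at most alpha_p + B / L, uniformly in b ([error_rate]). *)

(** * Independence and iterated integrals *)

Section independence.
Context (d : measure_display) (T : measurableType d) (R : realType).
Variable P : probability T R.

(** The joint law of independent elements is the product of their laws, so
    one of them may be frozen while the other is integrated. *)
Lemma independent_integral_prod d1 d2 (T1 : measurableType d1)
    (T2 : measurableType d2) (U : T -> T1) (V : T -> T2)
    (mU : measurable_fun setT U) (mV : measurable_fun setT V)
    (UV : forall A B, measurable A -> measurable B ->
      P (U @^-1` A `&` V @^-1` B) = (P (U @^-1` A) * P (V @^-1` B))%E)
    (f : T1 * T2 -> \bar R) :
  measurable_fun setT f -> (forall z, 0 <= f z)%E ->
  (\int[P]_w f (U w, V w) = \int[P]_w \int[P]_w' f (U w, V w'))%E.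
Proof.
move=> mf f0.
have mUV : measurable_fun setT (fun w => (U w, V w)).
  exact: measurable_fun_pair.
pose U' : {mfun T >-> T1} := HB.pack U (isMeasurableFun.Build _ _ _ _ _ mU).
pose V' : {mfun T >-> T2} := HB.pack V (isMeasurableFun.Build _ _ _ _ _ mV).
pose UV' : {mfun T >-> (T1 * T2)%type} :=
  HB.pack (fun w => (U w, V w)) (isMeasurableFun.Build _ _ _ _ _ mUV).
have prodE : forall X, measurable X ->
    (distribution P U' \x distribution P V')%E X = distribution P UV' X.
  by apply: product_measure_unique => A B mA mB; rewrite /= -UV.
transitivity (\int[distribution P UV']_z f z)%E.
  by rewrite ge0_integral_distribution.
rewrite (@eq_measure_integral _ _ _ _
  (distribution P U' \x distribution P V')%E);
  last by move=> A mA _; rewrite /= prodE.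
rewrite fubini_tonelli1// ge0_integral_distribution//=; last 2 first.
  exact: measurable_fun_fubini_tonelli_F.
  by move=> y; apply: integral_ge0 => z _; exact: f0.
apply: eq_integral => w _ /=; rewrite /fubini_F ge0_integral_distribution//.
exact: measurable_fun_pair2.
Qed.

(** The sets independent of a given event form a Dynkin system, hence
    independence extends from a pi-system to the sigma-algebra it generates. *)
Lemma independent_sigma_algebra (C : set (set T)) (B : set T) :
  setI_closed C -> C `<=` measurable -> measurable B ->
  (forall A, C A -> P (A `&` B) = (P A * P B)%E) ->
  forall A, <<s C >> A -> P (A `&` B) = (P A * P B)%E.
Proof.
move=> CI Cm mB CB.
suff : <<s C >> `<=` [set A | measurable A /\ P (A `&` B) = (P A * P B)%E].
  by move=> H A /H[].
rewrite -setI_closed_g_dynkin_g_sigma_algebra//.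
apply: smallest_sub; last by move=> A CA; split; [exact: Cm|exact: CB].
(* The value is made finite so that it can be moved out of differences and
   series. *)
have PBE : P B = (fine (P B))%:E by rewrite fineK// fin_num_measure.
split => /=.
- by split => //; rewrite setTI probability_setT mul1e.
- move=> A [mA AB]; split; first exact: measurableC.
  rewrite setIC -setDE measureD//; last first.
    by rewrite -ge0_fin_numE// fin_num_measure.
  rewrite /= (setIC B A) AB probability_setC// PBE muleC [in RHS]muleC muleBr//.
  by rewrite mule1.
- move=> F tF HF.
  have mF i : measurable (F i) by have [] := HF i.
  split; first exact: bigcup_measurable.
  rewrite setI_bigcupl measure_bigcup//; last 2 first.
    by move=> i _; exact: measurableI.
    exact: trivIset_setIr.
  rewrite measure_bigcup// muleC PBE -nneseriesZl//.
  by apply: eq_eseriesr => i _; have [_ Fi] := HF i; rewrite [LHS]Fi PBE muleC.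
Qed.

End independence.

(** * Splitting the coordinates of an independent family *)

Section coordinates.
Context (d : measure_display) (T : measurableType d) (R : realType).
Variable P : probability T R.
Context (I : finType) (Z : I -> T -> R).

Definition coord_events (J : {set I}) : set (set T) :=
  \bigcup_(i in [set` J]) g_sigma_algebra_preimage (Z i).

(** The pi-system behind [independent_coord].  The sets B i are given
    for all i so that two rectangles can be intersected termwise. *)
Definition coord_rectangles (J : {set I}) : set (set T) :=
  [set A | exists2 B : I -> set T,
    (forall i, g_sigma_algebra_preimage (Z i) (B i)) &
    A = \bigcap_(i in [set` J]) B i].

Lemma measurable_coord (J : {set I}) i : i \in J ->
  measurable_fun setT (Z i : g_sigma_algebraType (coord_events J) -> R).
Proof.
move=> iJ _ B mB; apply: sub_sigma_algebra; exists i => //.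
by exists B.
Qed.

Hypothesis mZ : forall i, measurable_fun setT (Z i).

Lemma preimage_coord_measurable i :
  g_sigma_algebra_preimage (Z i) `<=` measurable.
Proof. by move=> _ [B mB <-]; exact: mZ. Qed.

Lemma sigma_coord_measurable (J : {set I}) :
  <<s coord_events J >> `<=` measurable.
Proof.
apply: smallest_sub; first exact: sigma_algebra_measurable.
by move=> A [i _]; exact: preimage_coord_measurable.
Qed.

(** The identity, seen as a random element of the space equipped with
    the coarser sigma-algebra of the coordinates in J: this makes the group of
    these coordinates a single random element. *)
Lemma measurable_id_coord (J : {set I}) :
  @measurable_fun _ _ T (g_sigma_algebraType (coord_events J)) setT id.
Proof.
by move=> _ A mA; rewrite setTI; exact: (@sigma_coord_measurable J).
Qed.

Lemma measurable_forget_coord d' (S : measurableType d') (J : {set I})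
    (h : T -> S) :
  @measurable_fun _ _ (g_sigma_algebraType (coord_events J)) S setT h ->
  measurable_fun setT h.
Proof.
move=> mh _ B mB; apply: (@sigma_coord_measurable J).
exact: mh.
Qed.

Lemma preimage_coordT i : g_sigma_algebra_preimage (Z i) setT.
Proof. by exists setT => //; rewrite setTI preimage_setT. Qed.

Lemma preimage_coordI i : setI_closed (g_sigma_algebra_preimage (Z i)).
Proof.
move=> _ _ [B1 mB1 <-] [B2 mB2 <-]; exists (B1 `&` B2).
  exact: measurableI.
by rewrite !setTI.
Qed.

Lemma coord_rectanglesI (J : {set I}) : setI_closed (coord_rectangles J).
Proof.
move=> _ _ [A1 hA1 ->] [A2 hA2 ->]; exists (fun i => A1 i `&` A2 i).
  by move=> i; exact: preimage_coordI.
by rewrite bigcapI.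
Qed.

Lemma coord_rectangles_measurable (J : {set I}) :
  coord_rectangles J `<=` measurable.
Proof.
move=> _ [A hA ->]; apply: fin_bigcap_measurable => [|i _].
  exact: finite_finset.
by apply: preimage_coord_measurable; exact: hA.
Qed.

Lemma sigma_coord_rectangles (J : {set I}) :
  <<s coord_events J >> `<=` <<s coord_rectangles J >>.
Proof.
apply: smallest_sub; first exact: smallest_sigma_algebra.
move=> A [i iJ hA]; apply: sub_sigma_algebra.
exists (fun j => if j == i then A else setT).
  by move=> j; case: eqP => [->//|_]; exact: preimage_coordT.
apply/seteqP; split=> [w Aw j _|w /(_ i iJ)]; last by rewrite eqxx.
by case: eqP.
Qed.

Hypothesis indepZ :
  independent_family P (fun i => g_sigma_algebra_preimage (Z i)).

Lemma independent_rectangles (J K : {set I}) A B : [disjoint J & K]%bool ->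
  coord_rectangles J A -> coord_rectangles K B ->
  P (A `&` B) = (P A * P B)%E.
Proof.
move=> JK [A' hA ->] [B' hB ->].
(* One family for both rectangles, possible as J and K are disjoint. *)
pose C i := if i \in J then A' i else B' i.
have CJ : \bigcap_(i in [set` J]) A' i = \bigcap_(i in [set` J]) C i.
  by apply: eq_bigcapr => i /= iJ; rewrite /C iJ.
have CK : \bigcap_(i in [set` K]) B' i = \bigcap_(i in [set` K]) C i.
  by apply: eq_bigcapr => i /= iK; rewrite /C (disjointFl JK iK).
have hC (L : {set I}) :
    P (\bigcap_(i in [set` L]) C i) = (\prod_(i in L) P (C i))%E.
  by apply: indepZ => i _; rewrite /C; case: ifP.
rewrite CJ CK !hC -bigcap_setU (_ : _ `|` _ = [set` J :|: K]%SET); last first.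
  by apply/seteqP; split => i /=; rewrite inE => /orP.
by rewrite hC -bigU//; apply: eq_bigl => i; rewrite !inE.
Qed.

(** Both sides are extended in turn from rectangles, where independence is
    the product formula, to the generated sigma-algebras. *)
Lemma independent_coord (J K : {set I}) A B : [disjoint J & K]%bool ->
  <<s coord_events J >> A -> <<s coord_events K >> B ->
  P (A `&` B) = (P A * P B)%E.
Proof.
move=> JK /sigma_coord_rectangles mA mB.
have mB' := sigma_coord_measurable mB.
move/sigma_coord_rectangles in mB.
apply: independent_sigma_algebra mA => //.
- exact: coord_rectanglesI.
- exact: coord_rectangles_measurable.
- move=> A' mA'; rewrite setIC muleC.
  apply: independent_sigma_algebra mB => //.
  + exact: coord_rectanglesI.
  + exact: coord_rectangles_measurable.
  + exact: coord_rectangles_measurable mA'.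
  + move=> B' mB''; have KJ : [disjoint K & J]%bool by rewrite disjoint_sym.
    exact: (independent_rectangles KJ mB'' mA').
Qed.

(** A function of all the coordinates is written on the diagonal of the
    product of two copies of the space, one carrying the coordinates in J and
    the other those in K; independence replaces the diagonal by the product.
    The inner integral is a conditional expectation given the coordinates
    in J. *)
Lemma integral_coord_split (J K : {set I}) : [disjoint J & K]%bool ->
  forall f : g_sigma_algebraType (coord_events J) *
             g_sigma_algebraType (coord_events K) -> \bar R,
  measurable_fun setT f -> (forall z, 0 <= f z)%E ->
  (\int[P]_w f (w, w) = \int[P]_w \int[P]_w' f (w, w'))%E.
Proof.
move=> JK f mf f0.
apply: (@independent_integral_prod _ _ _ P _ _ _ _
  (id : T -> g_sigma_algebraType (coord_events J))
  (id : T -> g_sigma_algebraType (coord_events K))) => //.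
- exact: measurable_id_coord.
- exact: measurable_id_coord.
- by move=> A B mA mB; exact: independent_coord JK mA mB.
Qed.

Lemma expectation_prod_coord (g : I -> R -> R) (s : seq I) : uniq s ->
  (forall i, measurable_fun setT (g i)) -> (forall i x, 0 <= g i x) ->
  (\int[P]_w (\prod_(i <- s) g i (Z i w))%:E =
   \prod_(i <- s) \int[P]_w (g i (Z i w))%:E)%E.
Proof.
move=> + mg g0; elim: s => [_|i s IH /= /andP[is_ us]].
  under eq_integral do rewrite big_nil.
  by rewrite big_nil integral_cst//= mul1e probability_setT.
rewrite big_cons -(IH us).
pose J : {set I} := [set i]%SET; pose K : {set I} := [set j in s]%SET.
have JK : [disjoint J & K]%bool by rewrite disjoints1 inE.
pose f (z : g_sigma_algebraType (coord_events J) *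
            g_sigma_algebraType (coord_events K)) : \bar R :=
  (g i (Z i z.1) * \prod_(j <- s) g j (Z j z.2))%:E.
have mgi : measurable_fun setT
    (fun z : g_sigma_algebraType (coord_events J) => g i (Z i z)).
  by apply: measurableT_comp => //; apply: measurable_coord; rewrite inE.
have mgs : measurable_fun setT (fun z : g_sigma_algebraType (coord_events K) =>
    \prod_(j <- s) g j (Z j z)).
  apply: measurable_prod => j js; apply: measurableT_comp => //.
  by apply: measurable_coord; rewrite inE.
have gs0 w : 0 <= \prod_(j <- s) g j (Z j w) by apply: prodr_ge0 => j _.
transitivity (\int[P]_w f (w, w))%E.
  by apply: eq_integral => w _; rewrite big_cons.
rewrite (integral_coord_split JK); last 2 first.
- apply/measurable_EFinP; apply: measurable_funM.
    exact: measurableT_comp mgi measurable_fst.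
  exact: measurableT_comp mgs measurable_snd.
- by move=> z; rewrite lee_fin mulr_ge0.
under eq_integral => w _.
  rewrite /f /=; under eq_integral do rewrite EFinM.
  rewrite ge0_integralZl//;
    [|by apply/measurable_EFinP/(@measurable_forget_coord _ _ K)|
    by move=> w' _; rewrite lee_fin|by rewrite lee_fin].
  over.
rewrite /= ge0_integralZr//.
- by apply/measurable_EFinP/(@measurable_forget_coord _ _ J).
- by move=> w _; rewrite lee_fin.
- by apply: integral_ge0 => w _; rewrite lee_fin.
Qed.

End coordinates.

(** * Two Gaussian integrals *)

Section gaussian_integrals.
Context (R : realType).
Notation mu := (@lebesgue_measure R).

Lemma integral_normal_prob (m s : R) (f : R -> \bar R) :
  measurable_fun setT f -> (forall x, 0 <= f x)%E ->
  (\int[normal_prob m s]_x f x = \int[mu]_x (f x * (normal_pdf m s x)%:E))%E.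
Proof.
move=> mf f0.
have dom := normal_prob_dominates m s.
have int_rn := Radon_Nikodym_SigmaFinite.f_integrable dom.
have mpdf : measurable_fun setT (fun x : R => (normal_pdf m s x)%:E).
  by apply/measurable_EFinP; exact: measurable_normal_pdf.
rewrite -(Radon_Nikodym_SigmaFinite.change_of_variables dom)//.
apply: ae_eq_integral => //.
- by apply: emeasurable_funM => //; exact: measurable_int int_rn.
- exact: emeasurable_funM.
- apply: ae_eqe_mul2l; apply: integral_ae_eq => // A _ mA.
  by rewrite -Radon_Nikodym_SigmaFinite.f_integral.
Qed.

(** Both Gaussian integrals below come from recognising the integrand as a
    multiple of another normal density. *)
Lemma integral_scaled_pdf (f : R -> R) (m s c : R) :
  measurable_fun setT f -> (forall x, 0 <= f x) -> 0 <= c ->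
  (forall x, f x * normal_pdf 0 1 x = c * normal_pdf m s x) ->
  (\int[normal_prob 0%R 1%R]_x (f x)%:E = c%:E)%E.
Proof.
move=> mf f0 c0 fE; rewrite integral_normal_prob//; last first.
  exact/measurable_EFinP.
under eq_integral do rewrite -EFinM fE EFinM.
rewrite ge0_integralZl//.
- by rewrite integral_normal_pdf mule1.
- by apply/measurable_EFinP; exact: measurable_normal_pdf.
- by move=> x _; rewrite lee_fin normal_pdf_ge0.
Qed.

(** Completing the square turns exp(c x) phi(x) into exp(c^2/2) phi(x - c),
    where phi is the standard normal density. *)
Lemma normal_mgf (c : R) :
  (\int[normal_prob 0%R 1%R]_x (expR (c * x))%:E = (expR (c ^+ 2 / 2))%:E)%E.
Proof.
apply: (@integral_scaled_pdf _ c 1) => //.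
- by apply: measurableT_comp => //; exact: measurable_funM.
- move=> x; rewrite !normal_pdfE// mulrCA [RHS]mulrCA; congr (_ * _).
  by rewrite /normal_fun -!expRD; congr expR; field.
Qed.

Lemma expR_quadratic_le (x : R) : 0 <= x -> expR (x - x ^+ 2) <= 1 + x.
Proof.
move=> x0.
have den : 0 < 1 - (x - x ^+ 2) by nra.
have := expR_ge1Dx (- (x - x ^+ 2)).
rewrite expRN => h; rewrite -[leLHS]invrK.
rewrite invf_ple ?posrE ?invr_gt0 ?expR_gt0//; last lra.
apply: le_trans h; rewrite -[leLHS]mul1r ler_pdivrMr; last lra.
nra.
Qed.

(** The integral equals (1 + 2 l)^(-1/2), by rescaling the density; the
    exponential upper bound is the form in which products over independent
    coordinates are taken. *)
Lemma normal_square_laplace (l : R) : 0 <= l ->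
  (\int[normal_prob 0%R 1%R]_x (expR (- (l * x ^+ 2)))%:E <=
   (expR (- (l - 2 * l ^+ 2)))%:E)%E.
Proof.
move=> l0; pose q := 1 + 2 * l; have q0 : 0 < q by rewrite /q; lra.
pose s := (Num.sqrt q)^-1; have s0 : 0 < s by rewrite invr_gt0 sqrtr_gt0.
have sE : s ^+ 2 = q^-1 by rewrite exprVn sqr_sqrtr// ltW.
rewrite (@integral_scaled_pdf _ 0 s s).
- rewrite lee_fin -(@ler_pXn2r _ 2) ?nnegrE ?expR_ge0 ?(ltW s0)//.
  rewrite sE -expRM_natl invf_ple ?posrE ?expR_gt0// -expRN.
  apply: le_trans (expR_quadratic_le _); last by rewrite mulr_ge0.
  by rewrite ler_expR; lra.
- apply: measurableT_comp => //; apply: measurableT_comp => //.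
  by apply: measurable_funM => //; exact: measurable_funX.
- by [].
- exact: ltW.
- move=> x; rewrite !normal_pdfE ?gt_eqF//.
  have -> : normal_peak s = s^-1 * normal_peak 1.
    rewrite /normal_peak expr1n mul1r -mulrnAr sqrtrM ?sqr_ge0// invfM.
    by rewrite sqrtr_sqr gtr0_norm.
  rewrite !mulrA divff ?gt_eqF// mul1r mulrAC mulrC [RHS]mulrC -mulrA mulrC.
  congr (_ * _).
  rewrite /normal_fun -!expRD; congr expR.
  by rewrite !subr0 sE expr1n -[q^-1 *+ 2]mulr_natr invfM invrK /q; field.
Qed.

End gaussian_integrals.

(** * Tail bounds for independent standard normal variables *)

Section gaussian_tails.
Context (d : measure_display) (T : measurableType d) (R : realType).
Variable P : probability T R.
Context (I : finType) (Z : I -> T -> R).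
Hypothesis normZ : std_normal P Z.

Let mZ i : measurable_fun setT (Z i).
Proof. by case: normZ. Qed.

Let indepZ : independent_family P (fun i => g_sigma_algebra_preimage (Z i)).
Proof. by case: normZ. Qed.

Lemma probability_le_integral (A : set T) (h : T -> R) :
  measurable A -> measurable_fun setT h -> (forall w, 0 <= h w) ->
  (forall w, A w -> 1 <= h w) -> (P A <= \int[P]_w (h w)%:E)%E.
Proof.
move=> mA mh h0 h1.
rewrite -[leLHS]mul1e -(integral_cst _ mA) [leLHS]integral_mkcond.
apply: ge0_le_integral => //.
- by move=> w _; rewrite patchE; case: ifP.
- by apply/(measurable_restrictT _ mA); exact: measurable_cst.
- exact/measurable_EFinP.
- move=> w _; rewrite patchE; case: ifPn => wA; rewrite lee_fin//.
  by apply: h1; move: wA; rewrite inE.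
Qed.

Lemma expectation_normal_coord (g : R -> R) i :
  measurable_fun setT g -> (forall x, 0 <= g x) ->
  (\int[P]_w (g (Z i w))%:E = \int[normal_prob 0%R 1%R]_x (g x)%:E)%E.
Proof.
move=> mg g0.
have mZi : measurable_fun setT (Z i : T -> measurableTypeR R) := mZ i.
have mEg : measurable_fun [set: measurableTypeR R] (EFin \o g).
  by apply/measurable_EFinP; exact: mg.
pose Y : {mfun T >-> measurableTypeR R} := HB.pack (Z i)
  (isMeasurableFun.Build _ _ _ _ _ mZi).
rewrite -(@ge0_integral_distribution _ _ _ _ _ P Y (EFin \o g))//.
by apply: eq_measure_integral => A mA _; case: normZ => _ + _; exact.
Qed.

Lemma expectation_exp_linear (s : seq I) (c : I -> R) : uniq s ->
  (\int[P]_w (expR (\sum_(i <- s) c i * Z i w))%:E =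
   (expR ((\sum_(i <- s) c i ^+ 2) / 2))%:E)%E.
Proof.
move=> us; under eq_integral do rewrite expR_sum.
rewrite (expectation_prod_coord mZ indepZ
  (g := fun i x => expR (c i * x)) us); last 2 first.
- by move=> i; apply: measurableT_comp => //; exact: measurable_funM.
- by move=> i x; exact: expR_ge0.
rewrite mulr_suml expR_sum -prodEFin; apply: eq_bigr => i _.
rewrite (expectation_normal_coord (g := fun x => expR (c i * x))) ?normal_mgf//.
by apply: measurableT_comp => //; exact: measurable_funM.
Qed.

Lemma expectation_exp_squares (s : seq I) (l : R) : uniq s -> 0 <= l ->
  (\int[P]_w (expR (- (l * \sum_(i <- s) Z i w ^+ 2)))%:E <=
   (expR (- (l - 2 * l ^+ 2) *+ size s))%:E)%E.
Proof.
move=> us l0; under eq_integral do rewrite mulr_sumr -sumrN expR_sum.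
have mg : measurable_fun setT (fun x : R => expR (- (l * x ^+ 2))).
  apply: measurableT_comp => //; apply: measurableT_comp => //.
  by apply: measurable_funM => //; exact: measurable_funX.
rewrite (expectation_prod_coord mZ indepZ
  (g := fun i x => expR (- (l * x ^+ 2))) us)//.
elim: s {us} => [|i s IH]; first by rewrite !big_nil mulr0n expR0.
rewrite big_cons mulrS expRD EFinM; apply: lee_pmul => //.
- by apply: integral_ge0 => w _; rewrite lee_fin.
- apply: prode_ge0 => j _.
  by apply: integral_ge0 => w _; rewrite lee_fin.
- by rewrite (expectation_normal_coord (g := fun x => expR (- (l * x ^+ 2))))//;
    exact: normal_square_laplace.
Qed.

(** Chernoff bound for a chi-square variable: the lower tail involves
    exp(- l Z^2), which is bounded, so that every l >= 0 may be used. *)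
Lemma normal_square_lower_tail (s : seq I) (u : R) : uniq s -> 0 <= u ->
  (P [set w | (\sum_(i <- s) Z i w ^+ 2 < (1 - u) * (size s)%:R)%R] <=
   (expR (- (u ^+ 2 / 8 * (size s)%:R)))%:E)%E.
Proof.
(* u / 4 optimises the exponent l u - 2 l^2, which becomes u^2 / 8. *)
move=> us u0; pose l := u / 4; pose m : R := (size s)%:R.
have l0 : 0 <= l by rewrite /l; lra.
have mS : measurable_fun setT (fun w => \sum_(i <- s) Z i w ^+ 2).
  by apply: measurable_sum => i; exact: measurable_funX.
set A := (X in P X).
have mA : measurable A.
  by rewrite -[A]setTI; exact: (measurable_fun_ltr mS).
have mL : measurable_fun setT
    (fun w => expR (- (l * \sum_(i <- s) Z i w ^+ 2))).
  apply: measurableT_comp => //.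
  by apply: measurableT_comp => //; exact: measurable_funM.
pose e := expR (l * ((1 - u) * m)).
have le1 := @probability_le_integral A
  (fun w => e * expR (- (l * \sum_(i <- s) Z i w ^+ 2))) mA
  (measurable_funM (measurable_cst e) mL)
  (fun w => mulr_ge0 (expR_ge0 _) (expR_ge0 _)).
apply: (le_trans (le1 _)) => [w /= Aw|].
  by rewrite -expRD -[leLHS]expR0 ler_expR -mulrBr mulr_ge0// subr_ge0 ltW.
under eq_integral do rewrite EFinM.
rewrite ge0_integralZl//; last 2 first.
- exact/measurable_EFinP.
- by rewrite lee_fin expR_ge0.
apply: (@le_trans _ _ (e%:E * (expR (- (l - 2 * l ^+ 2) *+ size s))%:E)%E).
  by apply: lee_wpmul2l; [rewrite lee_fin expR_ge0|
    exact: expectation_exp_squares].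
rewrite -EFinM lee_fin -expRD ler_expR -mulr_natr -/m /l.
by rewrite le_eqVlt; apply/orP; left; apply/eqP; field.
Qed.

(** The coefficients may depend on the coordinates in J, which are
    independent of those entering the sum.  The exponential moment is computed
    with the former frozen and is at most exp(l^2 v / 2) on H; the bound follows
    with the usual choice l = t / v. *)
Lemma conditional_gaussian_tail (J : {set I}) (c : I -> T -> R)
    (H : set T) (v t : R) :
  (forall i, measurable_fun setT
    (c i : g_sigma_algebraType (coord_events Z J) -> R)) ->
  <<s coord_events Z J >> H ->
  (forall w, H w -> \sum_(i in ~: J) c i w ^+ 2 <= v) ->
  0 < v -> 0 <= t ->
  (P (H `&` [set w | (t <= \sum_(i in ~: J) c i w * Z i w)%R]) <=
   (expR (- (t ^+ 2 / (2 * v))))%:E)%E.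
Proof.
move=> mc mH Hv v0 t0; pose K := (~: J)%SET; pose l := t / v.
have l0 : 0 <= l by rewrite divr_ge0// ltW.
have JK : [disjoint J & K]%bool by rewrite finset.disjoints_subset finset.setCK.
pose TJ := g_sigma_algebraType (coord_events Z J).
pose TK := g_sigma_algebraType (coord_events Z K).
pose S (w w' : T) := \sum_(i in K) c i w * Z i w'.
pose f (z : TJ * TK) : \bar R := (\1_H z.1 * expR (l * S z.1 z.2))%:E.
have mH1 : measurable_fun setT (\1_H : TJ -> R) by exact: measurable_indic.
have mf : measurable_fun setT f.
  apply/measurable_EFinP; apply: measurable_funM.
    exact: (measurableT_comp mH1 measurable_fst).
  apply: measurableT_comp => //; apply: measurable_funM => //.
  rewrite /S; under eq_fun do rewrite -big_enum/=.
  (* Only the indices in K give measurable terms. *)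
  have -> : (fun z : TJ * TK => \sum_(i <- enum K) c i z.1 * Z i z.2) =
      (fun z => \sum_(i <- enum K) if i \in K then c i z.1 * Z i z.2 else 0).
    by apply/funext => z; apply: eq_big_seq => i; rewrite mem_enum => ->.
  apply: measurable_sum => i; case: (boolP (i \in K)) => // iK.
  apply: measurable_funM.
    exact: (measurableT_comp (mc i) measurable_fst).
  have mZi : measurable_fun [set: TK] (Z i : TK -> R) := measurable_coord iK.
  exact: (measurableT_comp mZi measurable_snd).
have f0 z : (0 <= f z)%E by rewrite lee_fin mulr_ge0.
pose g w := \1_H w * expR (l ^+ 2 * (\sum_(i <- enum K) c i w ^+ 2) / 2).
have Ef : (\int[P]_w f (w, w) = \int[P]_w (g w)%:E)%E.
  rewrite (integral_coord_split mZ indepZ JK)//.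
    apply: eq_integral => w _; rewrite /f /g /=.
    under eq_integral do rewrite EFinM.
    rewrite ge0_integralZl//; last first.
      apply/measurable_EFinP; apply: measurableT_comp => //.
      apply: measurable_funM => //; rewrite /S.
      under eq_fun do rewrite -big_enum/=.
      by apply: measurable_sum => i; exact: measurable_funM.
    under eq_integral do rewrite /S -big_enum mulr_sumr.
    under eq_integral do under eq_bigr do rewrite mulrA.
    rewrite (expectation_exp_linear _ (enum_uniq (mem K))) -EFinM mulr_sumr.
    by under [in LHS]eq_bigr do rewrite exprMn.
have Eg : (\int[P]_w f (w, w) <= (expR (l ^+ 2 * v / 2))%:E)%E.
  rewrite Ef -[leRHS]mule1 -(@probability_setT _ _ _ P) -integral_cst//.
  apply: ge0_le_integral => //.
  - by move=> w _; rewrite lee_fin mulr_ge0.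
  - apply/measurable_EFinP.
    have mg : measurable_fun [set: TJ] (g : TJ -> R).
      apply: measurable_funM => //.
      apply: measurableT_comp => //; apply: measurable_funM => //.
      apply: measurable_funM => //; apply: measurable_sum => i.
      exact: measurable_funX.
    exact: (measurable_forget_coord mZ mg).
  - move=> w _; rewrite lee_fin /g indicE; case: (boolP (w \in H)) => [|_].
      rewrite inE mul1r ler_expR ler_pM2r ?invr_gt0// big_enum => /Hv ?.
      by rewrite ler_wpM2l// sqr_ge0.
    by rewrite mul0r.
have mA : measurable (H `&` [set w | t <= S w w]).
  apply: measurableI; first exact: (sigma_coord_measurable mZ mH).
  rewrite -[X in measurable X]setTI; apply: measurable_fun_ler => //.
  rewrite /S; under eq_fun do rewrite -big_enum/=.
  apply: measurable_sum => i; apply: measurable_funM => //.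
  exact: (measurable_forget_coord mZ (mc i)).
pose e := expR (- (l * t)).
have mff : measurable_fun setT (fun w => \1_H w * expR (l * S w w)).
  apply/measurable_EFinP.
  have mdiag : measurable_fun setT (fun w : T => ((w, w) : TJ * TK)).
    by apply: measurable_fun_pair; exact: measurable_id_coord.
  exact: (measurableT_comp mf mdiag).
have le1 : (P (H `&` [set w | (t <= S w w)%R]) <=
    \int[P]_w (e * (\1_H w * expR (l * S w w)))%:E)%E.
  apply: probability_le_integral => //.
  - exact: measurable_funM.
  - by move=> w; apply: mulr_ge0; [exact: expR_ge0|rewrite mulr_ge0].
  - move=> w [Hw tS]; rewrite indicE mem_set// mul1r -expRD -[leLHS]expR0.
    by rewrite ler_expR addrC -mulrBr mulr_ge0// subr_ge0.
apply: (le_trans le1); under eq_integral do rewrite EFinM.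
rewrite ge0_integralZl//; last 2 first.
- exact/measurable_EFinP.
- by rewrite lee_fin expR_ge0.
apply: (@le_trans _ _ (e%:E * (expR (l ^+ 2 * v / 2))%:E)%E).
  by apply: lee_wpmul2l; rewrite ?lee_fin ?expR_ge0.
rewrite -EFinM lee_fin -expRD ler_expR /l.
by rewrite le_eqVlt; apply/orP; left; apply/eqP; field; rewrite gt_eqF.
Qed.

End gaussian_tails.

(** * The entries of the design and of the noise *)

Section regression_coordinates.
Context (d : measure_display) (T : measurableType d) (R : realType).
Variable P : probability T R.

Lemma independent_familyT (I : finType) (F : I -> set (set T)) :
  independent_family P F -> forall A : I -> set T, (forall i, F i (A i)) ->
  P (\bigcap_i A i) = (\prod_i P (A i))%E.
Proof.
move=> indF A FA; have := indF [set: I]%SET A (fun i _ => FA i).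
have -> : [set` [set: I]%SET] = [set: I].
  by apply/seteqP; split => i //=; rewrite inE.
by move=> ->; apply: eq_bigl => i; rewrite inE.
Qed.

(** Events outside J may be replaced by the whole space, so only the product
    formula over all the indices has to be checked. *)
Lemma independent_family_of_full (I : finType) (F : I -> set (set T)) :
  (forall i, F i setT) ->
  (forall A : I -> set T, (forall i, F i (A i)) ->
    P (\bigcap_i A i) = (\prod_i P (A i))%E) ->
  independent_family P F.
Proof.
move=> FT full J A FA; pose B i := if i \in J then A i else setT.
have -> : \bigcap_(i in [set` J]) A i = \bigcap_i B i.
  apply/seteqP; split => [w Aw i _|w Bw i /= iJ].
    by rewrite /B; case: ifPn => // iJ; exact: Aw.
  by have := Bw i Logic.I; rewrite /B iJ.
rewrite full; last by move=> i; rewrite /B; case: ifPn => // /FA.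
rewrite [RHS]big_mkcond; apply: eq_bigr => i _; rewrite /B.
by case: ifPn => // _; rewrite probability_setT.
Qed.

Context (n p n1 : nat).
Context (X : T -> 'M[R]_(n, p)) (E : T -> 'cV[R]_n) (part : T -> {set 'I_n}).
Hypothesis model : regression_model P n1 X E part.

Definition regression_coord (ij : 'I_n * 'I_p + 'I_n) (w : T) : R :=
  dataset_coord ij (X w, E w).
Local Notation Z := regression_coord.

(** The independence assumptions are nested: between the design and the
    noise, between the rows of the design, and inside each row.  They combine
    into the mutual independence of all the entries. *)
Lemma std_normal_regression_coord : std_normal P Z.
Proof.
have [rn ri nn dn _ _ _] := model.
split.
- move=> [[i j]|i]; first by have [+ _ _] := rn i; exact.
  by have [+ _ _] := nn; exact.
- move=> [[i j]|i] B mB; first by have [_ + _] := rn i; exact.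
  by have [_ + _] := nn; exact.
apply: independent_family_of_full.
  by move=> i; exists setT => //; rewrite setTI preimage_setT.
move=> A FA.
have -> : \bigcap_k A k =
    (\bigcap_(ij : 'I_n * 'I_p) A (inl ij)) `&` (\bigcap_(i : 'I_n) A (inr i)).
  apply/seteqP; split => [w Aw|w [Aw1 Aw2] [ij|i] _].
  - by split => i _; exact: Aw.
  - exact: Aw1.
  - exact: Aw2.
rewrite dn; last 2 first.
- apply: (@fin_bigcap_measurable _ (g_sigma_algebraType _)).
    exact: finite_finset.
  move=> [i j] _; apply: sub_sigma_algebra; exists (i, j) => //.
  exact: (FA (inl (i, j))).
- apply: (@fin_bigcap_measurable _ (g_sigma_algebraType _)).
    exact: finite_finset.
  move=> i _; apply: sub_sigma_algebra; exists i => //.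
  exact: (FA (inr i)).
rewrite big_sumType/=; congr (_ * _)%E; last first.
  by have [_ _ /independent_familyT->//] := nn => i; exact: (FA (inr i)).
have -> : \bigcap_(ij : 'I_n * 'I_p) A (inl ij) =
    \bigcap_(i : 'I_n) \bigcap_(j : 'I_p) A (inl (i, j)).
  apply/seteqP; split => [w Aw i _ j _|w Aw [i j] _]; first exact: Aw.
  exact: Aw.
rewrite (independent_familyT ri); last first.
  move=> i; apply: (@fin_bigcap_measurable _ (g_sigma_algebraType _)).
    exact: finite_finset.
  move=> j _; apply: sub_sigma_algebra; exists j => //.
  exact: (FA (inl (i, j))).
transitivity (\prod_(i < n) \prod_(j < p) P (A (inl (i, j))))%E.
  apply: eq_bigr => i _.
  by have [_ _ /independent_familyT->//] := rn i => j; exact: (FA (inl (i, j))).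
by rewrite pair_bigA/=; apply: eq_bigr => -[].
Qed.

End regression_coordinates.

(** * The screening statistic *)

Section screening_algebra.
Context (R : realType).

Lemma sqnorm2_ge0 m (v : 'cV[R]_m) : 0 <= sqnorm2 v.
Proof. by apply: sumr_ge0 => i _; exact: sqr_ge0. Qed.

Lemma norm2_sqr m (v : 'cV[R]_m) : norm2 v ^+ 2 = sqnorm2 v.
Proof. by rewrite sqr_sqrtr// sqnorm2_ge0. Qed.

(** The identity also holds when the column vanishes: every quotient by u is
    then 0. *)
Lemma Delta_decomposition m p (X : 'M[R]_(m, p)) (b h : 'cV[R]_p)
    (e : 'cV[R]_m) i : let u := norm2 (col i X) in
  Delta (X, X *m b + e) h i = u * b i 0 +
    \sum_l X l i / u * (e l 0 + \sum_(j | j != i) X l j * (b j 0 - h j 0)).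
Proof.
move=> u; rewrite /Delta /= -/u mxE.
have -> : u * b i 0 = (\sum_l X l i ^+ 2) / u * b i 0.
  congr (_ * _); have -> : \sum_l X l i ^+ 2 = u ^+ 2.
    by rewrite norm2_sqr; apply: eq_bigr => l _; rewrite mxE.
  have [->|u0] := eqVneq u 0; first by rewrite invr0 mulr0.
  by rewrite expr2 mulfK.
rewrite !mulr_suml -big_split/=; apply: eq_bigr => l _.
rewrite !mxE (bigD1 i)//= summxE.
have -> : \sum_(j | j != i) X l j * (b j 0 - h j 0) =
    \sum_(j | j != i) X l j * b j 0 - \sum_(j | j != i) h j 0 * X l j.
  by rewrite -sumrB; apply: eq_bigr => j _; ring.
have -> : \sum_(j | j != i) (h j 0 *: col j X) l 0 =
    \sum_(j | j != i) h j 0 * X l j.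
  by apply: eq_bigr => j _; rewrite !mxE.
ring.
Qed.

Lemma subsample_sampleE U n p (X : U -> 'M[R]_(n, p)) (E : U -> 'cV[R]_n) b w
    (A : {set 'I_n}) :
  let X' := rowsub (@enum_val _ (mem A)) (X w) in
  subsample (sample X E b w) A =
    (X', X' *m b + rowsub (@enum_val _ (mem A)) (E w)).
Proof.
rewrite /subsample /=; congr pair; apply/matrixP => l j; rewrite !mxE.
by congr (_ + _); apply: eq_bigr => k _; rewrite !mxE.
Qed.

(** Measurability of an estimator refers to the sigma-algebra generated by
    the entries of the data set, so it can be pulled back along any map into
    data sets with measurable entries. *)
Lemma measurable_estimator_comp d (S : measurableType d) m p
    (bhat : dataset R m p -> 'cV[R]_p) (phi : S -> dataset R m p) :
  measurable_estimator bhat ->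
  (forall ij, measurable_fun setT (fun w => dataset_coord ij (phi w))) ->
  forall j, measurable_fun setT (fun w => bhat (phi w) j 0).
Proof.
move=> mb mphi j _ B mB; rewrite setTI.
suff : sigma_of (@dataset_coord R m p) `<=` [set Q | measurable (phi @^-1` Q)].
  by move=> /(_ _ (mb j B mB)).
apply: smallest_sub.
  split => /=.
  - by rewrite preimage_set0.
  - by move=> Q mQ; rewrite setTD preimage_setC; exact: measurableC.
  - by move=> Q mQ; rewrite preimage_bigcup; exact: bigcup_measurable.
move=> _ [ij _ [C mC <-]] /=; rewrite setTI -[X in measurable X]setTI.
exact: mphi.
Qed.

Lemma measurable_inv_sqrt d (S : measurableType d) (g : S -> R) :
  measurable_fun setT g -> (forall w, 0 <= g w) ->
  measurable_fun setT (fun w => (Num.sqrt (g w))^-1).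
Proof.
move=> mg g0.
rewrite (_ : (fun _ => _) = (fun w => g w `^ (- 2^-1))); last first.
  by apply/funext => w; rewrite powRN powR12_sqrt.
exact: (measurableT_comp (@measurable_powR R (- 2^-1))).
Qed.

End screening_algebra.

(** * Noise of the statistic for a fixed split *)

Section fixed_partition.
Context (d : measure_display) (T : measurableType d) (R : realType).
Variable P : probability T R.
Context (n p : nat) (X : T -> 'M[R]_(n, p)) (E : T -> 'cV[R]_n).
Local Notation Z := (regression_coord X E).
Hypothesis normZ : std_normal P Z.
Context (b : 'cV[R]_p) (A : {set 'I_n}) (bhat : dataset R #|A| p -> 'cV[R]_p).
Hypothesis mbhat : measurable_estimator bhat.

Definition estimate (w : T) : 'cV[R]_p :=
  bhat (subsample (sample X E b w) A).

(** What is held fixed when the noise of the i-th statistic is studied: the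
    first part of the sample, and the i-th column of the design. *)
Definition revealed (i : 'I_p) : {set 'I_n * 'I_p + 'I_n} :=
  [set k | match k with
           | inl (m, j) => (m \in A) || (j == i)
           | inr m => m \in A
           end]%SET.

Let TJ J := g_sigma_algebraType (coord_events Z J).

Lemma measurable_estimate (J : {set 'I_n * 'I_p + 'I_n}) j :
  (forall m j, m \in A -> inl (m, j) \in J) ->
  (forall m, m \in A -> inr m \in J) ->
  measurable_fun setT (fun w : TJ J => estimate w j 0).
Proof.
move=> AJX AJE; apply: (measurable_estimator_comp mbhat) => -[[l j']|l] /=.
  have eA := enum_valP l.
  rewrite (_ : (fun _ => _) = Z (inl (enum_val l, j'))).
    by apply: measurable_coord; exact: AJX.
  by apply/funext => w; rewrite mxE.
have eA := enum_valP l.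
rewrite (_ : (fun _ => _) = (fun w => \sum_j X w (enum_val l) j * b j 0
    + Z (inr (enum_val l)) w)); last by apply/funext => w; rewrite !mxE.
apply: measurable_funD; last by apply: measurable_coord; exact: AJE.
apply: measurable_sum => j'; apply: measurable_funM => //.
have := @measurable_coord _ _ _ _ Z J (inl (enum_val l, j')); apply; exact: AJX.
Qed.

Definition col_sqnorm (i : 'I_p) (w : T) : R := \sum_(m in ~: A) X w m i ^+ 2.

(** Outside [revealed i], these are the coefficients of the Gaussian linear
    form [noise i]. *)
Definition noise_coef (i : 'I_p) (k : 'I_n * 'I_p + 'I_n) (w : T) : R :=
  match k with
  | inl (m, j) => X w m i / Num.sqrt (col_sqnorm i w) * (b j 0 - estimate w j 0)
  | inr m => X w m i / Num.sqrt (col_sqnorm i w)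
  end.

Definition noise (i : 'I_p) (w : T) : R :=
  \sum_(k in ~: revealed i) noise_coef i k w * Z k w.

Lemma col_sqnorm_ge0 i w : 0 <= col_sqnorm i w.
Proof. by apply: sumr_ge0 => m _; exact: sqr_ge0. Qed.

Lemma norm2_test_col i w :
  norm2 (col i (subsample (sample X E b w) (~: A)%SET).1) =
  Num.sqrt (col_sqnorm i w).
Proof.
rewrite /norm2 /sqnorm2 /col_sqnorm [in RHS]big_enum_val; congr Num.sqrt.
by apply: eq_bigr => l _; rewrite !mxE.
Qed.

Lemma sum_hidden i (F : 'I_n * 'I_p + 'I_n -> R) :
  \sum_(k in ~: revealed i) F k =
  \sum_(m in ~: A) (F (inr m) + \sum_(j | j != i) F (inl (m, j))).
Proof.
rewrite big_sumType/= addrC big_split/=; congr (_ + _).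
  by apply: eq_bigl => m; rewrite !inE.
rewrite pair_big_dep/=; apply: eq_big => [[m j]|[m j] _ //].
by rewrite !inE negb_or.
Qed.

Lemma Delta_test i w :
  Delta (subsample (sample X E b w) (~: A)%SET) (estimate w) i =
  Num.sqrt (col_sqnorm i w) * b i 0 + noise i w.
Proof.
rewrite -norm2_test_col subsample_sampleE /= Delta_decomposition; congr (_ + _).
rewrite -[norm2 _]/(norm2 (col i (subsample (sample X E b w) (~: A)%SET).1)).
rewrite norm2_test_col /noise sum_hidden [RHS]big_enum_val.
apply: eq_bigr => l _; rewrite /= !mxE mulrDr mulr_sumr; congr (_ + _).
by apply: eq_bigr => j _; rewrite !mxE; ring.
Qed.

(** The weights X_mi / |X_i| form a unit vector (or vanish), and each of
    them multiplies a vector whose squared norm is 1 + sum_(j != i)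
    (b_j - h_j)^2. *)
Lemma noise_coef_sqr_sum i w :
  \sum_(k in ~: revealed i) noise_coef i k w ^+ 2 <=
  1 + sqnorm2 (estimate w - b).
Proof.
rewrite sum_hidden /=.
set u := Num.sqrt _; set h := sqnorm2 _.
apply: (@le_trans _ _ (\sum_(m in ~: A) (X w m i / u) ^+ 2 * (1 + h))).
  apply: ler_sum => m _; rewrite mulrDr mulr1 lerD2l.
  under eq_bigr do rewrite exprMn.
  rewrite -mulr_sumr ler_wpM2l ?sqr_ge0//.
  rewrite /h /sqnorm2 [leRHS](bigD1 i)//= -[leLHS]add0r lerD ?sqr_ge0//.
  apply: ler_sum => j _; rewrite !mxE.
  by rewrite -[leLHS]sqrrN opprB.
rewrite -mulr_suml ler_piMl//; first by rewrite addr_ge0 ?sqnorm2_ge0.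
under eq_bigr do rewrite exprMn.
rewrite -mulr_suml -/(col_sqnorm i w) exprVn sqr_sqrtr ?col_sqnorm_ge0//.
have [->|u0] := eqVneq (col_sqnorm i w) 0; first by rewrite mul0r.
by rewrite divff.
Qed.

Lemma measurable_col_sqnorm i (J : {set 'I_n * 'I_p + 'I_n}) :
  revealed i \subset J -> measurable_fun setT (col_sqnorm i : TJ J -> R).
Proof.
move=> iJ; rewrite /col_sqnorm; under eq_fun do rewrite -big_enum/=.
apply: measurable_sum => m; apply: measurable_funX.
have := @measurable_coord _ _ _ _ Z J (inl (m, i)); apply.
by apply: (fintype.subsetP iJ); rewrite inE eqxx orbT.
Qed.

Lemma measurable_noise_coef i k (J : {set 'I_n * 'I_p + 'I_n}) :
  revealed i \subset J -> measurable_fun setT (noise_coef i k : TJ J -> R).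
Proof.
move=> iJ.
have mX m : measurable_fun setT (fun w : TJ J => X w m i).
  have := @measurable_coord _ _ _ _ Z J (inl (m, i)); apply.
  by apply: (fintype.subsetP iJ); rewrite inE eqxx orbT.
have mu : measurable_fun setT (fun w : TJ J => (Num.sqrt (col_sqnorm i w))^-1).
  by apply: measurable_inv_sqrt; [exact: measurable_col_sqnorm|
    exact: col_sqnorm_ge0].
case: k => [[m j]|m] /=; last exact: measurable_funM.
apply: measurable_funM; first exact: measurable_funM.
apply: measurable_funB => //; apply: measurable_estimate => [m' j' mA|m' mA];
  by apply: (fintype.subsetP iJ); rewrite inE mA.
Qed.

Definition accurate (eps : R) : set T :=
  [set w | sqnorm2 (estimate w - b) <= eps].

Lemma measurable_accurate eps (J : {set 'I_n * 'I_p + 'I_n}) :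
  (forall m j, m \in A -> inl (m, j) \in J) ->
  (forall m, m \in A -> inr m \in J) ->
  <<s coord_events Z J >> (accurate eps).
Proof.
move=> AJX AJE.
have mh : measurable_fun setT (fun w : TJ J => sqnorm2 (estimate w - b)).
  rewrite /sqnorm2; apply: measurable_sum => j; apply: measurable_funX.
  under eq_fun do rewrite !mxE.
  by apply: measurable_funB => //; exact: measurable_estimate.
have := measurable_fun_ler mh (measurable_cst eps) measurableT.
by move=> /(_ [set true]); rewrite setTI; exact.
Qed.

Lemma measurable_noise i : measurable_fun setT
  (noise i : TJ [set: 'I_n * 'I_p + 'I_n]%SET -> R).
Proof.
rewrite /noise; under eq_fun do rewrite -big_enum/=.
apply: measurable_sum => k; apply: measurable_funM.
  by apply: measurable_noise_coef; exact: finset.subsetT.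
by apply: measurable_coord; rewrite inE.
Qed.

Let mZ i : measurable_fun setT (Z i).
Proof. by case: normZ. Qed.

(** The upper and the lower tail are the same one-sided bound, for the
    coefficients and for their opposites. *)
Lemma noise_tail i (eps t : R) : 0 <= eps -> 0 <= t ->
  (P (accurate eps `&` [set w | (t <= `|noise i w|)%R]) <=
   (2 * expR (- (t ^+ 2 / (2 * (1 + eps)))))%:E)%E.
Proof.
move=> eps0 t0.
have mH : <<s coord_events Z (revealed i) >> (accurate eps).
  by apply: measurable_accurate => [m j mA|m mA]; rewrite inE mA.
have mN := measurable_forget_coord mZ (@measurable_noise i).
have v0 : 0 < 1 + eps by rewrite ltr_pwDl.
have Hv w : accurate eps w ->
    \sum_(k in ~: revealed i) noise_coef i k w ^+ 2 <= 1 + eps.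
  by move=> ?; rewrite (le_trans (noise_coef_sqr_sum i w))// lerD2l.
have mc k : measurable_fun setT (noise_coef i k : TJ (revealed i) -> R).
  exact: measurable_noise_coef.
have up := conditional_gaussian_tail normZ mc mH Hv v0 t0.
have mcN k :
    measurable_fun setT (fun w : TJ (revealed i) => - noise_coef i k w).
  exact: measurableT_comp.
have HvN w : accurate eps w ->
    \sum_(k in ~: revealed i) (- noise_coef i k w) ^+ 2 <= 1 + eps.
  by under eq_bigr do rewrite sqrrN; exact: Hv.
have down := conditional_gaussian_tail normZ mcN mH HvN v0 t0.
have mle (g : T -> R) : measurable_fun setT g ->
    measurable (accurate eps `&` [set w | t <= g w]).
  move=> mg; apply: measurableI.
    exact: (sigma_coord_measurable mZ mH).
  by rewrite -[X in measurable X]setTI; apply: measurable_fun_ler.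
have mup := mle _ mN.
have mdown : measurable (accurate eps `&`
    [set w | t <= \sum_(k in ~: revealed i) - noise_coef i k w * Z k w]).
  apply: mle; rewrite (_ : (fun _ => _) = (fun w => - noise i w)).
    exact: measurableT_comp.
  by apply/funext => w; under eq_bigr do rewrite mulNr; rewrite sumrN.
rewrite mulr2n mulrDl !mul1r EFinD.
apply: le_trans (leeD up down); apply: le_trans (measureU2 _ mup mdown).
apply: le_measure; rewrite ?inE; [|exact: measurableU|].
- by apply: (mle (fun w => `|noise i w|)); exact: measurableT_comp.
- move=> w [Hw] /=; rewrite ler_normr => /orP[tw|tw]; [left|right];
    split => //=.
  by under eq_bigr do rewrite mulNr; rewrite sumrN.
Qed.

End fixed_partition.

(** * The threshold *)

Section threshold.
Context (R : realType).
Implicit Types a s q u x : R.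

Lemma kappaE a varsigma p m (u : 'cV[R]_m) :
  kappa a varsigma p u =
  (a * norm2 u) / 2 + (varsigma ^+ 2 * ln p%:R) / (a * norm2 u).
Proof. by []. Qed.

(** AM-GM: the threshold is smallest at x^2 = 2 s.  This is what protects the
    null coordinates for every positive length of the column. *)
Lemma threshold_lower x s : 0 < x -> 0 <= s ->
  Num.sqrt (2 * s) <= x / 2 + s / x.
Proof.
move=> x0 s0.
have t0 : 0 <= x / 2 + s / x by rewrite addr_ge0 ?divr_ge0// ltW.
rewrite -(@ler_pXn2r _ 2) ?nnegrE ?sqrtr_ge0// sqr_sqrtr ?mulr_ge0//.
rewrite -subr_ge0.
have -> : (x / 2 + s / x) ^+ 2 - 2 * s = (x / 2 - s / x) ^+ 2.
  by field; rewrite gt_eqF.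
exact: sqr_ge0.
Qed.

(** The gap x - (x/2 + s/x) = x/2 - s/x increases with x, so a lower bound on
    x^2 suffices. *)
Lemma threshold_gap x q s : 0 <= s -> 0 < q -> 2 * s <= q -> 0 <= x ->
  q <= x ^+ 2 ->
  0 <= Num.sqrt q / 2 - s / Num.sqrt q <= x - (x / 2 + s / x).
Proof.
move=> s0 q0 sq x0 qx; set y := Num.sqrt q.
have y0 : 0 < y by rewrite sqrtr_gt0.
have yq : y ^+ 2 = q by rewrite sqr_sqrtr// ltW.
have yx : y <= x by rewrite -(@ler_pXn2r _ 2) ?nnegrE ?(ltW y0)// yq.
have x0' : 0 < x by exact: lt_le_trans yx.
apply/andP; split.
  rewrite subr_ge0 ler_pdivrMr// mulrAC -expr2 yq; lra.
have -> : x - (x / 2 + s / x) = x / 2 - s / x by field; rewrite gt_eqF.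
apply: lerB; first by rewrite ler_wpM2r.
by rewrite ler_wpM2l// lef_pV2 ?posrE.
Qed.

End threshold.

(** * Error probability of one coordinate *)

Section screening_errors.
Context (d : measure_display) (T : measurableType d) (R : realType).
Variable P : probability T R.
Context (n p : nat) (X : T -> 'M[R]_(n, p)) (E : T -> 'cV[R]_n).
Local Notation Z := (regression_coord X E).
Hypothesis normZ : std_normal P Z.
Context (b : 'cV[R]_p) (A : {set 'I_n}) (bhat : dataset R #|A| p -> 'cV[R]_p).
Hypothesis mbhat : measurable_estimator bhat.
Local Notation estimate := (estimate X E b bhat).
Local Notation col_sqnorm := (@col_sqnorm _ T R n p X A).
Local Notation noise := (noise X E b bhat).
Local Notation accurate := (accurate X E b bhat).
Local Notation full := [set: 'I_n * 'I_p + 'I_n]%SET.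

Context (a varsigma : R).
Hypothesis a0 : 0 < a.
Let s : R := varsigma ^+ 2 * ln p%:R.

Definition selected (i : 'I_p) (w : T) : bool :=
  screen a varsigma (subsample (sample X E b w) (~: A)%SET) (estimate w) i 0.

Lemma selectedE i w : let x := a * Num.sqrt (col_sqnorm i w) in
  selected i w = (x / 2 + s / x <
    `|Num.sqrt (col_sqnorm i w) * b i 0 + noise i w|).
Proof. by rewrite /selected mxE kappaE norm2_test_col Delta_test. Qed.

Let mZ i : measurable_fun setT (Z i).
Proof. by case: normZ. Qed.

Lemma measurable_selected i :
  measurable_fun setT
    (selected i : g_sigma_algebraType (coord_events Z full) -> bool).
Proof.
rewrite [X in measurable_fun _ X](_ : _ = (fun w =>
  a * Num.sqrt (col_sqnorm i w) / 2 + s / (a * Num.sqrt (col_sqnorm i w)) <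
  `|Num.sqrt (col_sqnorm i w) * b i 0 + noise i w|)); last first.
  by apply/funext => w; rewrite selectedE.
have mc : measurable_fun setT
    (col_sqnorm i : g_sigma_algebraType (coord_events Z full) -> R).
  by apply: measurable_col_sqnorm; exact: finset.subsetT.
have msqrt : measurable_fun setT
    (fun w : g_sigma_algebraType (coord_events Z full) =>
      Num.sqrt (col_sqnorm i w)).
  under eq_fun do rewrite -powR12_sqrt ?col_sqnorm_ge0//.
  exact: (measurableT_comp (@measurable_powR R 2^-1)).
apply: measurable_fun_ltr.
  apply: measurable_funD; first by do 2 apply: measurable_funM => //.
  apply: measurable_funM => //; under eq_fun do rewrite invfM.
  apply: measurable_funM => //.
  by apply: measurable_inv_sqrt => // w; exact: col_sqnorm_ge0.
apply: measurableT_comp => //; apply: measurable_funD.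
  exact: measurable_funM.
exact: measurable_noise.
Qed.

Lemma noise_eq0 i w : col_sqnorm i w = 0 -> noise i w = 0.
Proof.
move=> u0; apply: big1 => k _.
have -> : noise_coef X E b bhat i k w = 0; last by rewrite mul0r.
by case: k => [[m j]|m]; rewrite /= u0 sqrtr0 invr0 mulr0 ?mul0r.
Qed.

Lemma sigma_accurate eps : <<s coord_events Z full >> (accurate eps).
Proof.
by apply: measurable_accurate => // [m j|m] _; rewrite inE.
Qed.

Lemma sigma_selected i (c : bool) :
  <<s coord_events Z full >> [set w | selected i w = c].
Proof.
have := @measurable_selected i measurableT [set c].
by rewrite setTI; exact.
Qed.

Let measurable_selected_event i c : measurable [set w | selected i w = c].
Proof. exact: (sigma_coord_measurable mZ (@sigma_selected i c)). Qed.

Let measurable_accurate_event eps : measurable (accurate eps).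
Proof. exact: (sigma_coord_measurable mZ (@sigma_accurate eps)). Qed.

Let measurable_noise_event i (t : R) : measurable [set w | t <= `|noise i w|].
Proof.
have mN := measurable_forget_coord mZ (measurable_noise b mbhat i).
rewrite -[X in measurable X]setTI; apply: measurable_fun_ler => //.
exact: measurableT_comp.
Qed.

Lemma null_selected_prob i (eps : R) : 0 <= eps -> 0 <= s -> b i 0 = 0 ->
  (P (accurate eps `&` [set w | selected i w = true]) <=
   (2 * expR (- (s / (1 + eps))))%:E)%E.
Proof.
move=> eps0 s0 bi0.
have t0 : 0 <= Num.sqrt (2 * s) by rewrite sqrtr_ge0.
have := noise_tail normZ b mbhat i eps0 t0.
have s20 : 0 <= 2 * s by rewrite mulr_ge0.
rewrite sqr_sqrtr// invfM mulrACA divff// mul1r.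
apply: le_trans.
apply: le_measure; rewrite ?inE; [exact: measurableI..|].
move=> w [Hw] /=; rewrite selectedE bi0 mulr0 add0r => sel; split => //=.
(* On a null column both the threshold and the statistic are 0. *)
have [u0|u0] := eqVneq (col_sqnorm i w) 0.
  move: sel; rewrite u0 sqrtr0 noise_eq0// normr0.
  by rewrite mulr0 mul0r invr0 mulr0 addr0 ltxx.
apply: le_trans (ltW sel); apply: threshold_lower => //.
by rewrite mulr_gt0// sqrtr_gt0 lt_def u0 col_sqnorm_ge0.
Qed.

Lemma col_sqnorm_lower_tail i (u : R) : 0 <= u ->
  (P [set w | (col_sqnorm i w < (1 - u) * #|(~: A)%SET|%:R)%R] <=
   (expR (- (u ^+ 2 / 8 * #|(~: A)%SET|%:R)))%:E)%E.
Proof.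
move=> u0.
pose l : seq ('I_n * 'I_p + 'I_n) := [seq inl (m, i) | m <- enum (~: A)%SET].
have ul : uniq l by rewrite map_inj_uniq ?enum_uniq// => m m' [].
have := normal_square_lower_tail normZ ul u0.
rewrite size_map -cardE; congr (P _ <= _)%E.
apply/seteqP; split => w /=;
  by rewrite /col_sqnorm big_map -big_enum.
Qed.

(** Either the column is too short, or the threshold is at distance at least
    (Num.sqrt q / 2 - s / Num.sqrt q) below a |X_i|, a distance that the noise
    has to bridge. *)
Lemma signal_missed_prob i (eps u q : R) : 0 <= eps -> 0 <= s -> 0 <= u <= 1 ->
  0 < q -> 2 * s <= q -> q <= a ^+ 2 * ((1 - u) * #|(~: A)%SET|%:R) ->
  a <= `|b i 0| ->
  (P (accurate eps `&` [set w | selected i w = false]) <=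
   (2 * expR (- ((Num.sqrt q / 2 - s / Num.sqrt q) ^+ 2 / (2 * (1 + eps)))) +
    expR (- (u ^+ 2 / 8 * #|(~: A)%SET|%:R)))%:E)%E.
Proof.
move=> eps0 s0 /andP[u0 u1] q0 sq qA abi.
set t := Num.sqrt q / 2 - s / Num.sqrt q.
have qq : q <= Num.sqrt q ^+ 2 by rewrite sqr_sqrtr// ltW.
have /andP[t0 _] := threshold_gap s0 q0 sq (sqrtr_ge0 q) qq.
rewrite EFinD; apply: le_trans (leeD (noise_tail normZ b mbhat i eps0 t0)
  (col_sqnorm_lower_tail i u0)).
have mcol : measurable
    [set w | (col_sqnorm i w < (1 - u) * #|(~: A)%SET|%:R)%R].
  rewrite -[X in measurable X]setTI; apply: measurable_fun_ltr => //.
  have := @measurable_col_sqnorm _ _ _ _ _ X E A i full (finset.subsetT _).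
  exact: measurable_forget_coord.
apply: le_trans (measureU2 _ _ _) => //; last exact: measurableI.
apply: le_measure; rewrite ?inE; [exact: measurableI| |].
  by apply: measurableU => //; exact: measurableI.
move=> w [Hw] /= /negbT; rewrite selectedE -leNgt => miss.
have [small|big] := ltP (col_sqnorm i w) ((1 - u) * #|(~: A)%SET|%:R).
  by right.
left; split => //=.
set x := a * Num.sqrt (col_sqnorm i w) in miss.
have x0 : 0 <= x by rewrite mulr_ge0 ?sqrtr_ge0// ltW.
have qx : q <= x ^+ 2.
  rewrite (le_trans qA)// exprMn sqr_sqrtr ?col_sqnorm_ge0//.
  by rewrite ler_wpM2l ?sqr_ge0.
have /andP[_ h] := threshold_gap s0 q0 sq x0 qx.
apply: le_trans h _.
have : x <= `|Num.sqrt (col_sqnorm i w) * b i 0|.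
  by rewrite normrM ger0_norm ?sqrtr_ge0// [leRHS]mulrC /x ler_wpM2r ?sqrtr_ge0.
have := ler_normB (Num.sqrt (col_sqnorm i w) * b i 0 + noise i w) (noise i w).
rewrite addrK; lra.
Qed.

End screening_errors.

(** * Finite unions and partitions *)

Section finite_unions.
Context (d : measure_display) (T : measurableType d) (R : realType).
Variable P : probability T R.

Lemma probability_finite_union (I : finType) (F : I -> set T) :
  (forall i, measurable (F i)) -> (P (\bigcup_i F i) <= \sum_i P (F i))%E.
Proof.
move=> mF.
have H (r : seq I) :
    (P (\big[setU/set0]_(i <- r) F i) <= \sum_(i <- r) P (F i))%E.
  elim: r => [|i r IH]; first by rewrite !big_nil measure0.
  rewrite !big_cons; apply: le_trans (leeD (lexx _) IH).
  by apply: measureU2 => //; exact: bigsetU_measurable.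
apply: le_trans (H (index_enum I)); rewrite (_ : \bigcup_i F i =
  \big[setU/set0]_(i <- index_enum I) F i)//.
rewrite -bigcup_seq; apply: eq_bigcupl; split => i _ //=.
exact: mem_index_enum.
Qed.

Lemma probability_finite_partition (I : finType) (f : T -> I) :
  (forall i, measurable (f @^-1` [set i])) ->
  (\sum_i P (f @^-1` [set i]) = 1)%E.
Proof.
move=> mf; rewrite -(@probability_setT _ _ _ P).
have -> : [set: T] = \bigcup_i (f @^-1` [set i]).
  by apply/seteqP; split => w _ //; exists (f w).
rewrite (@measure_fin_bigcup _ _ _ P _ [set: I])//.
- rewrite (_ : [set: I] = [set` predT]); last by apply/seteqP; split.
  by rewrite -(@bigfs _ _ _ _ (index_enum I))// ?index_enum_uniq// => i _;
    rewrite mem_index_enum.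
- exact: finite_finset.
- apply/trivIsetP => i j _ _ /eqP ij.
  by apply/seteqP; split => w // [/= -> /ij].
Qed.

End finite_unions.

(** * Averaging over the random split *)

Section random_partition.
Context (d : measure_display) (T : measurableType d) (R : realType).
Variable P : probability T R.
Context (n p n1 : nat).
Context (X : T -> 'M[R]_(n, p)) (E : T -> 'cV[R]_n) (part : T -> {set 'I_n}).
Hypothesis model : regression_model P n1 X E part.
Local Notation Z := (regression_coord X E).
Local Notation full := [set: 'I_n * 'I_p + 'I_n]%SET.

Let mZ i : measurable_fun setT (Z i).
Proof. by have [] := std_normal_regression_coord model. Qed.

(** The split is independent of the data: conditionally on its value A, the
    event B A keeps its probability. *)
Lemma partition_mixture (B : {set 'I_n} -> set T) (x : R) : 0 <= x ->
  (forall A : {set 'I_n}, #|A| = n1 ->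
    <<s coord_events Z full >> (B A) /\ (P (B A) <= x%:E)%E) ->
  measurable [set w | B (part w) w] /\ (P [set w | B (part w) w] <= x%:E)%E.
Proof.
move=> x0 HB; have [_ _ _ _ psize pmeas pind] := model.
(* Other sizes do not occur, and the hypothesis says nothing about them. *)
pose C (A : {set 'I_n}) :=
  if #|A| == n1 then part @^-1` [set A] `&` B A else set0.
have -> : [set w | B (part w) w] = \bigcup_A C A.
  apply/seteqP; split => [w /= Bw|w [A _]].
    by exists (part w) => //; rewrite /C psize eqxx.
  by rewrite /C; case: eqP => // _ [/= ->].
have mC A : measurable (C A).
  rewrite /C; case: eqP => // An; apply: measurableI; first exact: pmeas.
  by have [mB _] := HB A An; exact: (sigma_coord_measurable mZ mB).
split; first by apply: fin_bigcup_measurable => //; exact: finite_finset.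
apply: (le_trans (probability_finite_union P mC)).
rewrite -[leRHS]mule1 -(probability_finite_partition P pmeas) ge0_sume_distrr//.
apply: lee_sum => A _; rewrite /C; case: eqP => [An|_]; last first.
  by rewrite measure0 mule_ge0.
have [mB PB] := HB A An.
rewrite pind.
- by rewrite muleC; apply: lee_wpmul2r.
- by exists [set A] => //; rewrite setTI.
- apply: smallest_sub mB; first exact: smallest_sigma_algebra.
  by move=> Q [k _ Qk]; apply: sub_sigma_algebra; exists k.
Qed.

End random_partition.

(** * Error probability for a fixed split *)

Section recovery.
Context (d : measure_display) (T : measurableType d) (R : realType).
Variable P : probability T R.
Context (n p : nat) (X : T -> 'M[R]_(n, p)) (E : T -> 'cV[R]_n).
Local Notation Z := (regression_coord X E).
Local Notation full := [set: 'I_n * 'I_p + 'I_n]%SET.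
Context (b : 'cV[R]_p) (a varsigma : R).

Definition misselected (A : {set 'I_n}) (bhat : dataset R #|A| p -> 'cV[R]_p) :
    set T :=
  [set w | screen a varsigma (subsample (sample X E b w) (~: A)%SET)
             (estimate X E b bhat w) <> decoder b].

Lemma misselectedE (A : {set 'I_n}) (bhat : dataset R #|A| p -> 'cV[R]_p) :
  misselected bhat =
  \bigcup_i [set w | selected X E b bhat a varsigma i w = (b i 0 == 0)].
Proof.
apply/seteqP; split => w /=.
  move=> neq; apply: contrapT => H; apply: neq; apply/matrixP => i j.
  rewrite ord1 [RHS]mxE; apply/eqP; apply: contrapT => ne; apply: H.
  exists i => //=; rewrite /selected.
  by move: ne; case: (screen _ _ _ _ _ _) => /=; case: (b i 0 == 0).
move=> [i _] /= + eq; rewrite /selected eq mxE.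
by case: (b i 0 == 0).
Qed.

Lemma sigma_misselected (A : {set 'I_n}) (bhat : dataset R #|A| p -> 'cV[R]_p) :
  measurable_estimator bhat ->
  <<s coord_events Z full >> (misselected bhat).
Proof.
move=> mbhat; rewrite misselectedE.
apply: (@fin_bigcup_measurable _ (g_sigma_algebraType (coord_events Z full))).
  exact: finite_finset.
by move=> i _; exact: sigma_selected.
Qed.

Definition null_error (s eps : R) : R := 2 * expR (- (s / (1 + eps))).

Definition signal_error (s eps q u : R) (m : nat) : R :=
  2 * expR (- ((Num.sqrt q / 2 - s / Num.sqrt q) ^+ 2 / (2 * (1 + eps)))) +
  expR (- (u ^+ 2 / 8 * m%:R)).

Hypothesis normZ : std_normal P Z.

(** Union bound: each of the p coordinates is charged with the error of a
    null, and the sp signals with the error of a signal. *)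
Lemma misselected_prob (A : {set 'I_n}) (bhat : dataset R #|A| p -> 'cV[R]_p)
    (mbhat : measurable_estimator bhat) (sp : nat) (eps u q : R) :
  let s := varsigma ^+ 2 * ln p%:R in let m := #|(~: A)%SET| in
  0 < a -> signal_class sp a b ->
  0 <= eps -> 0 <= s -> 0 <= u <= 1 -> 0 < q -> 2 * s <= q ->
  q <= a ^+ 2 * ((1 - u) * m%:R) ->
  (P (accurate X E b bhat eps `&` misselected bhat) <=
   (p%:R * null_error s eps + sp%:R * signal_error s eps q u m)%:E)%E.
Proof.
move=> s m a0 [suppb minb] eps0 s0 u01 q0 sq qA.
have mZ k : measurable_fun setT (Z k) by case: normZ.
rewrite misselectedE setI_bigcupr.
apply: (le_trans (probability_finite_union P _)).
  move=> i; apply: measurableI;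
    apply: (@sigma_coord_measurable _ _ _ _ Z mZ full).
    exact: sigma_accurate.
  exact: sigma_selected.
have N0 : 0 <= null_error s eps by rewrite mulr_ge0.
have S0 : 0 <= signal_error s eps q u m by rewrite addr_ge0// mulr_ge0.
apply: (@le_trans _ _ (\sum_(i < p) (null_error s eps +
    (b i 0 != 0)%:R * signal_error s eps q u m)%:E)%E); last first.
  rewrite sumEFin lee_fin big_split/= sumr_const card_ord -mulr_suml mulr_natl.
  rewrite lerD2l ler_wpM2r// -natr_sum ler_nat -suppb.
  rewrite -sum1dep_card [leqRHS]big_mkcond/=.
  by apply: leq_sum => i _; case: (b i 0 != 0).
apply: lee_sum => i _; have [bi0|bi0] := eqVneq (b i 0) 0.
  rewrite mul0r addr0; exact: null_selected_prob.
apply: (@le_trans _ _ (signal_error s eps q u m)%:E); last first.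
  by rewrite lee_fin mul1r lerDr.
apply: signal_missed_prob => //.
by apply: minb; rewrite inE.
Qed.

End recovery.

(** * Error probability for a random split *)

Section ets_error.
Context (d : measure_display) (T : measurableType d) (R : realType).
Variable P : probability T R.
Context (n p n1 : nat).
Context (X : T -> 'M[R]_(n, p)) (E : T -> 'cV[R]_n) (part : T -> {set 'I_n}).
Hypothesis model : regression_model P n1 X E part.
Context (f : forall m, dataset R m p -> 'cV[R]_p -> R) (C : set 'cV[R]_p).
Context (Alg : iter_algorithm R p) (t : tuning Alg).
Local Notation full := [set: 'I_n * 'I_p + 'I_n]%SET.
Hypothesis mest : measurable_estimator
  (fun D : dataset R n1 p => alg_output (f D) C t).
Context (b : 'cV[R]_p) (a varsigma : R).

Let bhat (A : {set 'I_n}) (D : dataset R #|A| p) : 'cV[R]_p :=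
  alg_output (f D) C t.

Let mbhat (A : {set 'I_n}) : #|A| = n1 -> measurable_estimator (@bhat A).
Proof. by move=> An; move: mest; rewrite -An. Qed.

(** The event G need not be determined by the split and the first part of the
    data.  It is replaced by the event that the estimate is accurate, which
    contains it and to which [partition_mixture] applies; the complement of this
    event costs alpha. *)
Lemma ets_error_prob (sp : nat) (alpha eps u q : R) (G : set T) :
  let s := varsigma ^+ 2 * ln p%:R in let m := (n - n1)%N in
  0 < a -> signal_class sp a b ->
  0 <= eps -> 0 <= s -> 0 <= u <= 1 -> 0 < q -> 2 * s <= q ->
  q <= a ^+ 2 * ((1 - u) * m%:R) ->
  measurable G -> ((1 - alpha)%:E <= P G)%E ->
  (forall w, G w ->
    sqnorm2 (alg_output (f (subsample (sample X E b w) (part w))) C t - b)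
      <= eps) ->
  (P [set w | ets a varsigma f C t (sample X E b w) (part w) <> decoder b] <=
   (alpha + (p%:R * null_error s eps + sp%:R * signal_error s eps q u m))%:E)%E.
Proof.
move=> s m a0 bS eps0 s0 u01 q0 sq qm mG PG Gacc.
have normZ := std_normal_regression_coord model.
have s0' : 0 <= p%:R * null_error s eps + sp%:R * signal_error s eps q u m.
  by rewrite addr_ge0// mulr_ge0// ?addr_ge0// mulr_ge0.
pose acc A := accurate X E b (@bhat A) eps.
pose bad A := misselected X E b a varsigma (@bhat A).
have mZ k : measurable_fun setT (regression_coord X E k) by case: normZ.
have fullm Q : <<s coord_events (regression_coord X E) full >> Q ->
    (P Q <= 1%:E)%E.
  by move=> mQ; apply: probability_le1; exact: (sigma_coord_measurable mZ mQ).
have [mH _] : measurable [set w | acc (part w) w] /\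
    (P [set w | acc (part w) w] <= 1%:E)%E.
  apply: (partition_mixture model) => // A An.
  have mA : <<s coord_events (regression_coord X E) full >> (acc A).
    exact: (@sigma_accurate _ T R n p X E b A (@bhat A) (mbhat An) eps).
  by split => //; exact: fullm.
have [mB _] : measurable [set w | bad (part w) w] /\
    (P [set w | bad (part w) w] <= 1%:E)%E.
  apply: (partition_mixture model) => // A An.
  have mA : <<s coord_events (regression_coord X E) full >> (bad A).
    exact: (@sigma_misselected _ T R n p X E b a varsigma A (@bhat A)
      (mbhat An)).
  by split => //; exact: fullm.
have [_ PHB] : measurable [set w | (acc (part w) `&` bad (part w)) w] /\
    (P [set w | (acc (part w) `&` bad (part w)) w] <=
     (p%:R * null_error s eps + sp%:R * signal_error s eps q u m)%:E)%E.
  apply: (partition_mixture model (B := fun A => acc A `&` bad A)) => // A An.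
  have mE : m = #|(~: A)%SET| by rewrite /m cardsCs finset.setCK card_ord An.
  split.
    apply: (@measurableI _ (g_sigma_algebraType _)).
      exact: (@sigma_accurate _ T R n p X E b A (@bhat A) (mbhat An) eps).
    exact: (@sigma_misselected _ T R n p X E b a varsigma A (@bhat A)
      (mbhat An)).
  rewrite mE; apply: (misselected_prob normZ (mbhat An)) => //.
  by rewrite -mE.
have GH : G `<=` [set w | acc (part w) w] by move=> w /Gacc.
have PH : (P (~` [set w | acc (part w) w]) <= alpha%:E)%E.
  rewrite probability_setC// leeBlDr ?fin_num_measure//.
  rewrite -leeBlDl//; apply: (le_trans PG).
  by apply: le_measure; rewrite ?inE.
rewrite EFinD; apply: le_trans (leeD PH PHB).
apply: le_trans (measureU2 _ _ _); last 2 first.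
- exact: measurableC.
- exact: measurableI.
apply: le_measure; rewrite ?inE //.
  by apply: measurableU; [exact: measurableC|exact: measurableI].
move=> w badw; have [accw|?] := pselect (acc (part w) w); last by left.
by right; split.
Qed.

End ets_error.

(** * Decay of the error bound *)

Section rates.
Context (R : realType).
Implicit Types x L k : R.

Lemma natr_expR_ln p : 0 < ln (p%:R : R) -> p%:R = expR (ln p%:R) :> R.
Proof.
move=> L0; rewrite lnK// posrE ltNge; apply/negP => p0.
by move: L0; rewrite ln0// ltxx.
Qed.

Lemma expRN_le_inv x : 0 < x -> expR (- x) <= x^-1.
Proof.
move=> x0; rewrite expRN lef_pV2 ?posrE ?expR_gt0//.
by apply: le_trans (expR_ge1Dx x); rewrite lerDr.
Qed.

Lemma expRN_le_inv_sqr x : 0 < x -> expR (- x) <= 2 / x ^+ 2.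
Proof.
move=> x0; rewrite -[2 / _]invrK invf_div expRN.
rewrite lef_pV2 ?posrE ?expR_gt0//; last first.
  by rewrite divr_gt0// exprn_gt0.
apply: le_trans (expR_ge1Dxn 1 (ltW x0)).
by rewrite lerDr.
Qed.

(** With n >= k L, every term of the error bound is at most a constant times
    exp(- c L) or L exp(- c L), and so is O(1 / L). *)
Lemma error_rate (delta k K : R) : 0 < delta -> 0 < k -> 0 <= K ->
  exists2 B : R, 0 <= B & forall (p sp n m : nat) (L := ln p%:R : R)
    (s := (1 + 1 / 2 * delta) * L),
    0 < L -> sp%:R <= K * L -> k * L <= n%:R -> n%:R / 2 <= m%:R :> R ->
    p%:R * null_error s (1 / 4 * delta) +
    sp%:R * signal_error s (1 / 4 * delta) (2 * (1 + 3 / 4 * delta) * L)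
      (delta / (8 + 7 * delta)) m <= B / L.
Proof.
move=> d0 k0 K0; set eps := 1 / 4 * delta; set u := delta / (8 + 7 * delta).
have eps0 : 0 < eps by rewrite /eps; lra.
have u0 : 0 < u by rewrite divr_gt0//; lra.
pose c1 : R := 1 + 3 / 4 * delta.
have c10 : 0 < c1 by rewrite /c1; lra.
pose k1 : R := eps / (1 + eps).
pose k2 : R := eps ^+ 2 / (4 * c1 * (1 + eps)).
pose k3 : R := u ^+ 2 / 8 * (k / 2).
have k10 : 0 < k1 by rewrite divr_gt0//; lra.
have k20 : 0 < k2 by rewrite divr_gt0 ?exprn_gt0// !mulr_gt0//; lra.
have k30 : 0 < k3 by rewrite mulr_gt0// divr_gt0// exprn_gt0.
exists (2 / k1 + K * (4 / k2 ^+ 2 + 2 / k3 ^+ 2)).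
  apply: addr_ge0; first by rewrite divr_ge0// ltW.
  by apply: mulr_ge0 => //; apply: addr_ge0; rewrite divr_ge0 ?sqr_ge0.
move=> p sp n m L s L0 spL nL mn.
have pE : p%:R = expR L := natr_expR_ln L0.
have nullE : p%:R * null_error s eps = 2 * expR (- (k1 * L)).
  rewrite /null_error pE mulrCA -expRD; congr (2 * expR _).
  by rewrite /s /k1 /eps; field; lra.
have gapE : (Num.sqrt (2 * c1 * L) / 2 - s / Num.sqrt (2 * c1 * L)) ^+ 2 /
    (2 * (1 + eps)) = k2 * L.
  have q0 : 0 < 2 * c1 * L by rewrite !mulr_gt0.
  set y := Num.sqrt _; have y0 : 0 < y by rewrite sqrtr_gt0.
  have yq : y ^+ 2 = 2 * c1 * L by rewrite sqr_sqrtr// ltW.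
  have -> : y / 2 - s / y = (y ^+ 2 / 2 - s) / y by field; rewrite gt_eqF.
  rewrite expr_div_n yq /k2 /s /c1 /eps; field.
  by rewrite !gt_eqF//; lra.
rewrite nullE /signal_error gapE.
have e1 : 2 * expR (- (k1 * L)) <= 2 / k1 / L.
  by rewrite -mulrA ler_wpM2l// -invfM expRN_le_inv// mulr_gt0.
have e2 (c : R) : 0 < c -> L * expR (- (c * L)) <= 2 / c ^+ 2 / L.
  move=> c0; apply: (@le_trans _ _ (L * (2 / (c * L) ^+ 2))).
    by rewrite ler_wpM2l ?(ltW L0)// expRN_le_inv_sqr// mulr_gt0.
  rewrite le_eqVlt; apply/orP; left; apply/eqP; field.
  by rewrite !gt_eqF.
have e3 : expR (- (u ^+ 2 / 8 * m%:R)) <= expR (- (k3 * L)).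
  rewrite ler_expR lerN2 /k3 -mulrA ler_wpM2l ?divr_ge0 ?sqr_ge0//.
  by apply: le_trans mn; rewrite mulrAC ler_wpM2r.
have S0 : 0 <= 2 * expR (- (k2 * L)) + expR (- (k3 * L)).
  by rewrite addr_ge0// mulr_ge0.
rewrite [leRHS]mulrDl; apply: lerD e1 _.
apply: (@le_trans _ _ (K * L * (2 * expR (- (k2 * L)) + expR (- (k3 * L))))).
  by apply: ler_pM => //; rewrite ?lerD2l// addr_ge0// mulr_ge0.
rewrite -[K * L * _]mulrA -[K * _ / L]mulrA ler_wpM2l// mulrDr [leRHS]mulrDl.
apply: lerD; last exact: e2.
have -> : 4 / k2 ^+ 2 / L = 2 * (2 / k2 ^+ 2 / L).
  by field; rewrite !gt_eqF.
by rewrite mulrCA ler_wpM2l// e2.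
Qed.

End rates.

(** * The asymptotic regime *)

Section regime.
Context (R : realType).

Lemma near_ln_ge (M : R) : \forall p \near \oo, M <= ln (p%:R : R).
Proof.
near=> p.
have Mp : expR M <= p%:R by near: p; exact: nbhs_infty_ger.
by rewrite -[M]expRK ler_ln ?posrE ?expR_gt0// (lt_le_trans (expR_gt0 M)).
Unshelve. all: by end_near. Qed.

(** The inequality exp(k L) >= 1 + k L absorbs the rounding, and a growth of n
    linear in L is enough for s exp(- c n) to vanish. *)
Lemma nobs_ge (k : R) p : 0 < ln (p%:R : R) -> k * ln p%:R <= (nobs k p)%:R.
Proof.
move=> L0; have pE := natr_expR_ln L0.
have p0 : (p%:R : R) != 0 by rewrite pE gt_eqF ?expR_gt0.
have : p%:R `^ k < (nobs k p).+1%:R by exact: truncnS_gt.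
rewrite /powR (negbTE p0) -natr1 => h.
have := expR_ge1Dx (k * ln p%:R); lra.
Qed.

Lemma test_size_ge (gamma : R) n : 0 <= gamma <= 1 ->
  (1 - gamma) * n%:R <= (n - est_size gamma n)%:R.
Proof.
move=> /andP[g0 g1]; have gn : (est_size gamma n)%:R <= gamma * n%:R.
  by rewrite truncn_le mulr_ge0.
have en : (est_size gamma n <= n)%N.
  by rewrite -(ler_nat R) (le_trans gn)// ler_piMl.
by rewrite natrB//; lra.
Qed.

Lemma min_signal_sqr (r : R) n p : 0 <= r -> 0 <= ln (p%:R : R) ->
  min_signal r n p ^+ 2 = 2 * r * ln p%:R / n%:R.
Proof. by move=> r0 L0; rewrite sqr_sqrtr// divr_ge0 ?mulr_ge0. Qed.

(** The bound on gamma gives r (1 - gamma) >= 1 + 7 delta/8, and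
    delta / (8 + 7 delta) is the slack on the squared column length that leaves
    exactly 1 + 3 delta/4. *)
Lemma test_signal_strength (r gamma : R) n p (delta := r - 1) : 1 < r ->
  0 < gamma < delta / (8 + 8 * delta) -> 0 < ln (p%:R : R) -> (0 < n)%N ->
  2 * (1 + 3 / 4 * delta) * ln p%:R <=
  min_signal r n p ^+ 2 *
    ((1 - delta / (8 + 7 * delta)) * (n - est_size gamma n)%:R).
Proof.
move=> r1 /andP[g0 g1] L0 n0.
have d0 : 0 < delta by rewrite /delta subr_gt0.
have n0' : (0 : R) < n%:R by rewrite ltr0n.
have gd : gamma * (8 + 8 * delta) < delta by rewrite -ltr_pdivlMr//; lra.
have g2 : gamma <= 1 by nra.
have m0 := @test_size_ge gamma n.
rewrite min_signal_sqr ?(ltW L0)//; last lra.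
apply: (@le_trans _ _ (2 * r * ln p%:R / n%:R *
    ((1 - delta / (8 + 7 * delta)) * ((1 - gamma) * n%:R)))); last first.
  apply: ler_wpM2l; first by rewrite divr_ge0 ?mulr_ge0//; lra.
  apply: ler_wpM2l; last by apply: m0; rewrite (ltW g0).
  by rewrite subr_ge0 ler_pdivrMr; lra.
have -> : 2 * r * ln p%:R / n%:R *
    ((1 - delta / (8 + 7 * delta)) * ((1 - gamma) * n%:R)) =
    2 * (r * (1 - gamma) * ((8 + 6 * delta) / (8 + 7 * delta))) * ln p%:R.
  by field; rewrite gt_eqF//=; lra.
rewrite ler_pM2r// ler_pM2l// mulrA ler_pdivlMr; last lra.
have rg : (8 + 7 * delta) / 8 <= r * (1 - gamma).
  by rewrite ler_pdivrMr//; rewrite /delta in gd *; lra.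
apply: le_trans (ler_wpM2r _ rg); last lra.
by rewrite le_eqVlt; apply/orP; left; apply/eqP; field.
Qed.

(** A supremum over an empty class would be -oo, so the lower half of the
    squeeze needs a member. *)
Lemma signal_class_neq0 (p s : nat) (a : R) : 0 < a -> (s <= p)%N ->
  signal_class (R:=R) (p:=p) s a !=set0.
Proof.
move=> a0 sp; exists (\col_(j < p) (if (j < s)%N then a else 0)).
have suppE j : (j \in supp (\col_(j < p) (if (j < s)%N then a else 0))) =
    (j < s)%N.
  by rewrite inE mxE; case: ifP => _; rewrite ?eqxx// gt_eqF.
split; last by move=> j; rewrite suppE mxE => ->; rewrite gtr0_norm.
rewrite -sum1_card (eq_bigl _ _ suppE) (big_ord_narrow sp) sum_nat_const.
by rewrite card_ord muln1.
Qed.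

Lemma cvg_rate (B : R) (alpha : nat -> R) :
  alpha p @[p --> \oo] --> (0 : R) ->
  (alpha p + B / ln (p%:R : R))%:E @[p --> \oo] --> 0%E.
Proof.
move=> alpha0; apply: cvg_EFin; first by near=> p.
rewrite -[0 : R]addr0; apply: cvgD => //.
rewrite -(mulr0 B); apply: cvgMr.
apply/gtr0_cvgV0; last by apply/cvgryPge => M; exact: near_ln_ge.
by near=> p; apply: (@lt_le_trans _ _ 1) => //; near: p; exact: near_ln_ge.
Unshelve. all: by end_near. Qed.

End regime.

Theorem theorem5p1 (R : realType) :
  exists A1 A2 : R, [/\ 0 < A1, 0 < A2 &
  forall (k r gamma : R) (s : nat -> nat)
    (d : nat -> measure_display) (Om : forall p, measurableType (d p))
    (P : forall p, probability (Om p) R)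
    (X : forall p, Om p -> 'M[R]_(nobs k p, p))
    (E : forall p, Om p -> 'cV[R]_(nobs k p))
    (part : forall p, Om p -> {set 'I_(nobs k p)})
    (f : forall p m, dataset R m p -> 'cV[R]_p -> R)
    (C : forall p, set 'cV[R]_p)
    (Alg : forall p, iter_algorithm R p)
    (tau : forall p, R -> 'cV[R]_p -> tuning (Alg p))
    (T : R -> forall p, 'cV[R]_p -> R),
  let delta := r - 1 in
  let n p := nobs k p in
  let n1 p := est_size gamma (n p) in
  let a p := min_signal r (n p) p in
  let varsigma := Num.sqrt (1 + A2 * delta) in
  0 < k < 1 ->
  1 < r ->
  0 < gamma < delta / (8 + 8 * delta) ->
  (fun p => (s p)%:R : R) =O_\oo (fun p => ln p%:R : R) ->
  (forall p, regression_model (P p) (n1 p) (X p) (E p) (part p)) ->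
  (forall p (t : tuning (Alg p)), measurable_estimator
    (fun D : dataset R (n1 p) p => alg_output (f p _ D) (C p) t)) ->
  iteration_count_assumption s a P X E part f C tau T ->
  ereal_sup
    [set P p [set w | ets (a p) varsigma (f p) (C p) (tau p (A1 * delta) b)
                        (sample (X p) (E p) b w) (part p w) <> decoder b]
      | b in signal_class (s p) (a p)] @[p --> \oo] --> 0%E].
Proof.
exists (1 / 4), (1 / 2); split; [lra|lra|].
move=> k r gamma s d Om P X E part f C Alg tau T delta n n1 a varsigma.
move=> /andP[k0 k1] r1 grange sO model mest [alpha [alpha0 alphacvg] Hiter].
have d0 : 0 < delta by rewrite /delta subr_gt0.
have [g0 gd] := andP grange.
have ghalf : gamma <= 1 / 2.
  apply: le_trans (ltW gd) _; rewrite ler_pdivrMr; lra.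
have varsigmaE : varsigma ^+ 2 = 1 + 1 / 2 * delta.
  by rewrite sqr_sqrtr//; lra.
have [K K0 sK] : exists2 K : R, 0 < K &
    \forall p \near \oo, (s p)%:R <= K * ln (p%:R : R).
  have /eqO_exP[K K0 HK] := sO; exists K => //.
  near=> p.
  have L0 : 0 <= ln (p%:R : R) by near: p; exact: near_ln_ge.
  have : `|(s p)%:R : R| <= K * `|ln (p%:R : R)| by near: p; exact: HK.
  by rewrite !ger0_norm.
have [B B0 rate] := error_rate d0 k0 (ltW K0).
apply: (@squeeze_cvge _ _ _ _ (fun=> 0%E) _
  (fun p => (alpha p + B / ln (p%:R : R))%:E)); last 2 first.
- exact: cvg_cst.
- exact: cvg_rate.
near=> p.
have L1 : 1 <= ln (p%:R : R) by near: p; exact: near_ln_ge.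
have LK : 2 * K <= ln (p%:R : R) by near: p; exact: near_ln_ge.
have spK : (s p)%:R <= K * ln (p%:R : R) by near: p.
have L0 : 0 < ln (p%:R : R) by lra.
have kn : k * ln (p%:R : R) <= (n p)%:R by exact: nobs_ge.
have n0 : (0 < n p)%N.
  by rewrite -(ltr_nat R) (lt_le_trans _ kn)// mulr_gt0.
have a0 : 0 < a p.
  by rewrite sqrtr_gt0 divr_gt0 ?ltr0n// !mulr_gt0//; lra.
(* From p = exp L >= L^2 / 2 and s <= K L with L >= 2 K. *)
have sp : (s p <= p)%N.
  rewrite -(ler_nat R) (natr_expR_ln L0) (le_trans spK)//.
  apply: le_trans (expR_ge1Dxn 1 (ltW L0)).
  have : K * ln (p%:R : R) <= ln (p%:R : R) ^+ 2 / 2 by nra.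
  by move=> h; rewrite (le_trans h)// lerDr.
have [b0 b0S] := signal_class_neq0 a0 sp.
apply/andP; split.
  apply: (le_trans _ (ereal_sup_ubound (ex_intro2 _ _ b0 b0S erefl))).
  exact: measure_ge0.
apply: ge_ereal_sup => _ [b bS <-].
have [G [mG PG HG]] := Hiter p b bS.
(* gamma < 1/8, so at least half of the sample is kept for screening. *)
have m2 : (n p)%:R / 2 <= (n p - n1 p)%:R :> R.
  apply: le_trans (test_size_ge (gamma := gamma) _ _); last first.
    by rewrite (ltW g0); lra.
  have : (0 : R) <= (n p)%:R by [].
  nra.
have Gacc w : G w -> sqnorm2 (alg_output
    (f p _ (subsample (sample (X p) (E p) b w) (part p w))) (C p)
    (tau p (1 / 4 * delta) b) - b) <= 1 / 4 * delta.
  by move=> Gw; have [|_ +] := HG w Gw (1 / 4 * delta) => //; lra.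
apply: (le_trans (ets_error_prob (model p) (mest p (tau p (1 / 4 * delta) b))
  (varsigma := varsigma) (u := delta / (8 + 7 * delta))
  (q := 2 * (1 + 3 / 4 * delta) * ln p%:R)
  a0 bS _ _ _ _ _ _ mG PG Gacc)).
- lra.
- by rewrite mulr_ge0 ?sqr_ge0// ltW.
- by rewrite divr_ge0 ?ler_pdivrMr ?mul1r; lra.
- by rewrite !mulr_gt0//; lra.
- by rewrite varsigmaE; nra.
- exact: test_signal_strength.
- rewrite lee_fin lerD2l varsigmaE.
  exact: (rate p (s p) (n p) (n p - n1 p)%N L0 spK kn m2).
Unshelve. all: by end_near. Qed.
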